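(* Let $\mathcal{E}$ and $\widehat{\mathcal{E}}$ be two convex expectations on $\mathrm{USA}_b(\Omega;\mathbb{R})$ without fixed times of discontinuity. Then, for every $t\in\mathbb{R}$, the following are equivalent: (i) $\mathcal{E}_t(\varphi)\le\widehat{\mathcal{E}}_t(\varphi)$ for all $\varphi\in D_{t,\infty}$. (ii) $\mathcal{E}_t(\varphi)\le\widehat{\mathcal{E}}_t(\varphi)$ for all $\varphi\in\mathrm{USA}_b(\Omega;\mathbb{R})$.
   Context: Path space. Let $E$ be a Polish space and let $\Omega$ be either the space $D(\mathbb{R};E)$ of all càdlàg functions $\mathbb{R}\to E$ or the space $C(\mathbb{R};E)$ of all continuous functions, endowed with the two-sided Skorokhod $J_1$ topology (the local uniform topology if $\Omega=C(\mathbb{R};E)$). $X_t(\omega)=\omega(t)$, $t\in\mathbb{R}$, is the coordinate process; $\{\Delta X_s\neq0\}$ denotes $\{X_s\neq X_{s-}\}$. $\mathcal{F}=\sigma(X_t,t\in\mathbb{R})$ (the Borel $\sigma$-field of $\Omega$) and $\mathcal{F}_t=\sigma(X_s,s\le t)$. For a $\sigma$-field $\mathcal{G}$, a set is $\mathcal{G}$-analytic if it has the form $\bigcup_{(n_i)\in\mathbb{N}^\infty}\bigcap_{k\in\mathbb{N}}A_{n_1,\dots,n_k}$ with all $A_{n_1,\dots,n_k}\in\mathcal{G}$; a function $f$ is upper $\mathcal{G}$-semianalytic if $\{f\ge c\}$ is $\mathcal{G}$-analytic for all $c\in\mathbb{R}$. $\mathrm{USA}_b(\Omega,\mathcal{G};\mathbb{R})$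 is the set of bounded upper $\mathcal{G}$-semianalytic functions $\Omega\to\mathbb{R}$, $\mathrm{USA}_b(\Omega;\mathbb{R})=\mathrm{USA}_b(\Omega,\mathcal{F};\mathbb{R})$, and $\mathrm{USA}_b(\mathbb{R}\times\Omega;\mathbb{R})$ is defined analogously with $\mathcal{B}(\mathbb{R})\otimes\mathcal{F}$. $C_b$ denotes bounded continuous functions. For $t\in\mathbb{R}$, $D_{t,\infty}=\{g(X_{t_1},\dots,X_{t_n}):g\in C_b(E^n;\mathbb{R}),\ t<t_1<\dots<t_n<\infty,\ n\in\mathbb{N}\}$. Convex expectation. A convex expectation on $\mathrm{USA}_b(\Omega;\mathbb{R})$ is a map $\mathcal{E}:\mathrm{USA}_b(\Omega;\mathbb{R})\to\mathrm{USA}_b(\mathbb{R}\times\Omega;\mathbb{R})$, written $\mathcal{E}(\varphi)(t,\omega)=\mathcal{E}_t(\varphi)(\omega)$, such that: (E1) $\mathcal{E}_t(\varphi)\in\mathrm{USA}_b(\Omega,\mathcal{F}_t;\mathbb{R})$ for all $t\in\mathbb{R}$, $\varphi\in\mathrm{USA}_b(\Omega;\mathbb{R})$; (E2) $\mathcal{E}_t(\varphi)=\varphi$ for all $t$ and $\varphi\in\mathrm{USA}_b(\Omega,\mathcal{F}_t;\mathbb{R})$; (E3) $\mathcal{E}_t(\varphi)\le\mathcal{E}_t(\psi)$ whenever $\varphi\le\psi$; (E4) $\mathcal{E}_t(\lambda\varphi+(1-\lambda)\psi)\le\lambda\mathcal{E}_t(\varphi)+(1-\lambda)\mathcal{E}_t(\psi)$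 for $\lambda\in(0,1)$; (E5) $\omega\mapsto\mathcal{E}_t(\varphi)(\omega)$ is $\mathcal{F}_t$-measurable for all $t$ and $\varphi\in C_b(\Omega;\mathbb{R})$; (E6) $\mathcal{E}_t(\mathcal{E}_s(\varphi))=\mathcal{E}_t(\varphi)$ for all $s>t$ and $\varphi\in\mathrm{USA}_b(\Omega;\mathbb{R})$; (E7) for every $t$: $\mathcal{E}_t(\varphi_n)\searrow\mathcal{E}_t(\varphi)$ for all $(\varphi_n)\subset C_b(\Omega;\mathbb{R})$ with $\varphi_n\searrow\varphi\in\mathrm{USA}_b(\Omega;\mathbb{R})$, and $\mathcal{E}_t(\varphi_n)\nearrow\mathcal{E}_t(\varphi)$ for all $(\varphi_n)\subset\mathrm{USA}_b(\Omega;\mathbb{R})$ with $\varphi_n\nearrow\varphi\in\mathrm{USA}_b(\Omega;\mathbb{R})$. It has no fixed times of discontinuity if $\mathcal{E}_t(a\mathbf{1}_{\{\Delta X_s\ne0\}})(\omega)=0$ for all $t\in\mathbb{R}$, $\omega\in\Omega$, $s>t$, $a>0$. *)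

(* Defs.v *)
From HB Require Import structures.
From mathcomp Require Import all_boot all_order all_algebra.
From mathcomp Require Import all_classical all_reals all_analysis.

Set Implicit Arguments.
Unset Strict Implicit.
Unset Printing Implicit Defensive.

Import Order.TTheory GRing.Theory Num.Theory.
Import numFieldNormedType.Exports.

Local Open Scope classical_set_scope.
Local Open Scope ring_scope.

(* The metric of [E] is a fixed complete metric compatible with the Polish
   topology; it only serves to write down the path-space topologies, which do
   not depend on this choice. *)
Definition polish (R : realType) (E : metricType R) : Prop :=
  (exists2 D : set E, countable D & dense D) /\
  (forall u : nat -> E, cauchy (u @ \oo) -> exists l : E, u @ \oo --> l).

Section PathSpaces.
Context (R : realType) (E : metricType R).

Definition cadlag (w : R -> E) : Prop :=
  forall t : R, w r @[r --> t^'+] --> w t /\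
    exists l : E, w r @[r --> t^'-] --> l.

Definition cadlag_path : Type := set_type [set w : R -> E | cadlag w].

HB.instance Definition _ := Choice.on cadlag_path.

(* Continuity of a time change is automatic: a monotone bijection of the line
   is a homeomorphism. *)
Definition time_change (lam : R -> R) : Prop :=
  {homo lam : x y / x < y} /\ bijective lam.

Definition J1_close (N e : R) : set (cadlag_path * cadlag_path) :=
  [set p | exists2 lam : R -> R, time_change lam &
    (forall s : R, `|lam s - s| < e) /\
    (forall s : R, `|s| <= N ->
       mdist (set_val p.1 s) (set_val p.2 (lam s)) < e)].

(* The two-sided J1 topology: w_n --> w iff there are time changes lam_n with
   sup_s |lam_n s - s| --> 0 and, for every N,
   sup_(|s| <= N) d(w s, w_n (lam_n s)) --> 0.  Time changes are not required
   to fix the origin. *)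
Definition J1_entourage : set_system (cadlag_path * cadlag_path) :=
  [set A | exists N e : R, 0 < e /\ J1_close N e `<=` A].

Let J1_filter : Filter J1_entourage.
Proof.
split.
- by exists 0, 1.
- move=> A B [N [e [e0 sA]]] [M [f [f0 sB]]].
  exists (Num.max N M), (Num.min e f); split; first by rewrite lt_min e0.
  move=> p [lam tc [h1 h2]]; split.
  + apply: sA; exists lam => //; split=> s.
      by have := h1 s; rewrite lt_min => /andP[].
    move=> sN; have := h2 s; rewrite le_max sN lt_min => /(_ isT).
    by case/andP.
  + apply: sB; exists lam => //; split=> s.
      by have := h1 s; rewrite lt_min => /andP[].
    move=> sN; have := h2 s; rewrite le_max sN orbT lt_min => /(_ isT).
    by case/andP.
- move=> A B sAB [N [e [e0 sA]]]; exists N, e; split=> //.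
  exact: subset_trans sA sAB.
Qed.

Let J1_diagonal A : J1_entourage A -> (diagonal `<=` A)%relation.
Proof.
move=> [N [e [e0 sA]]] [x y] /diagonalP ->; apply: sA.
exists id; first by split=> //; exact: (Bijective (g := id)).
by split=> s /=; rewrite ?subrr ?normr0 // mdistxx.
Qed.

Let J1_inv A : J1_entourage A -> J1_entourage (A^-1)%relation.
Proof.
move=> [N [e [e0 sA]]]; exists (N + e), e; split=> //.
move=> [x y] [lam [inc [mu lamK muK]] [h1 h2]]; apply: sA; exists mu.
  split; last exact: (Bijective muK lamK).
  move=> a b ab; rewrite ltNge; apply/negP; rewrite le_eqVlt => /orP[/eqP ba|].
    by move: ab; rewrite -(muK a) -(muK b) ba ltxx.
  by move=> /inc; rewrite !muK => /(lt_trans ab); rewrite ltxx.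
have h s : `|mu s - s| < e by have := h1 (mu s); rewrite muK distrC.
split=> // s sN; rewrite metric_sym /=.
have := h2 (mu s); rewrite muK; apply.
rewrite -(subrK s (mu s)) addrC (le_trans (ler_normD _ _)) // lerD //.
exact: ltW.
Qed.

Let J1_split A : J1_entourage A ->
  exists2 B, J1_entourage B & (B \; B `<=` A)%relation.
Proof.
move=> [N [e [e0 sA]]]; have e20 : 0 < e / 2 by rewrite divr_gt0.
exists (J1_close (N + e / 2) (e / 2)).
  by exists (N + e / 2), (e / 2); split=> //; exact: subset_refl.
move=> [x z] [y [l1 [inc1 bij1] [h1 d1]] [l2 [inc2 bij2] [h2 d2]]].
apply: sA; exists (l2 \o l1).
  split; last exact: bij_comp.
  by move=> a b ab; apply/inc2/inc1.
split=> s /=.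
  rewrite (le_lt_trans (ler_distD (l1 s) _ _)) // (splitr e).
  by rewrite ltrD.
move=> sN; rewrite (le_lt_trans (metric_triangle _ (set_val y (l1 s)) _)) //.
rewrite (splitr e) ltrD //.
  by apply: d1; rewrite (le_trans sN) // lerDl ltW.
apply: d2; rewrite -(subrK s (l1 s)) addrC (le_trans (ler_normD _ _)) //.
by rewrite lerD // ltW.
Qed.

HB.instance Definition _ := @isUniform.Build cadlag_path
  J1_entourage J1_filter J1_diagonal J1_inv J1_split.

Definition continuous_path : Type :=
  set_type [set w : {family compact, R -> E} | continuous (w : R -> E)].

HB.instance Definition _ := Topological.on continuous_path.

End PathSpaces.

Inductive path_kind := CadlagPaths | ContinuousPaths.

Definition path_space (R : realType) (E : metricType R) (k : path_kind) :
    topologicalType :=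
  match k with
  | CadlagPaths => cadlag_path E
  | ContinuousPaths => continuous_path E
  end.

Definition coord_process (R : realType) (E : metricType R) (k : path_kind) :
    R -> path_space E k -> E :=
  match k with
  | CadlagPaths => fun t (w : cadlag_path E) => set_val w t
  | ContinuousPaths => fun t (w : continuous_path E) => set_val w t
  end.

Arguments coord_process {R} E k.

Definition borel (T : topologicalType) : set_system T := <<s @open T >>.

Definition analytic (T : Type) (G : set_system T) (A : set T) : Prop :=
  exists2 S : seq nat -> set T, (forall s, G (S s)) &
    A = \bigcup_(n in [set: nat -> nat])
          \bigcap_(k in [set: nat]) S (mkseq n k.+1).

Definition usab (R : realType) (T : Type) (G : set_system T) (f : T -> R) :
    Prop :=
  bounded_fun f /\ forall c : R, analytic G [set x | c <= f x].

Definition Cb (R : realType) (T : topologicalType) (f : T -> R) : Prop :=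
  continuous f /\ bounded_fun f.

Definition decreases_to (R : realType) (T : Type) (u : nat -> T -> R)
    (f : T -> R) : Prop :=
  forall x, nonincreasing_seq (u ^~ x) /\ u ^~ x @ \oo --> f x.

Definition increases_to (R : realType) (T : Type) (u : nat -> T -> R)
    (f : T -> R) : Prop :=
  forall x, nondecreasing_seq (u ^~ x) /\ u ^~ x @ \oo --> f x.

Section ConvexExpectations.
Context (R : realType) (E : metricType R).
Context (Omega : topologicalType) (X : R -> Omega -> E).

Definition coord_sigma (I : set R) : set_system Omega :=
  <<s \bigcup_(s in I) preimage_set_system setT (X s) (@borel E) >>.

Definition full_sigma : set_system Omega := coord_sigma setT.

Definition past_sigma (t : R) : set_system Omega :=
  coord_sigma [set s | s <= t].

Definition time_path_sigma : set_system (R * Omega) :=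
  <<s [set A `*` B | A in @borel R & B in full_sigma] >>.

Definition cylinder_after (t : R) (phi : Omega -> R) : Prop :=
  exists (n : nat) (ts : 'I_n.+1 -> R) (g : {ptws 'I_n.+1 -> E} -> R),
    [/\ forall i, t < ts i,
        {homo ts : i j / (i < j)%N >-> i < j},
        Cb g &
        phi = fun w => g (fun i => X (ts i) w)].

(* An expectation maps phi to the function (t, w) |-> EE phi t w.  It is
   represented by a total function on [Omega -> R]; its values outside of
   [usab full_sigma] are irrelevant. *)
Record convex_expectation (EE : (Omega -> R) -> R -> Omega -> R) : Prop := {
  ce_usab : forall phi, usab full_sigma phi ->
    usab time_path_sigma (fun p : R * Omega => EE phi p.1 p.2) ;
  ce_adapted : forall t phi, usab full_sigma phi ->
    usab (past_sigma t) (EE phi t) ;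
  ce_id : forall t phi, usab (past_sigma t) phi -> EE phi t = phi ;
  ce_monotone : forall t phi psi,
    usab full_sigma phi -> usab full_sigma psi ->
    (forall w, phi w <= psi w) -> forall w, EE phi t w <= EE psi t w ;
  ce_convex : forall t phi psi (lam : R),
    usab full_sigma phi -> usab full_sigma psi -> 0 < lam < 1 ->
    forall w, EE (fun w' => lam * phi w' + (1 - lam) * psi w') t w
              <= lam * EE phi t w + (1 - lam) * EE psi t w ;
  ce_measurable : forall t phi, Cb phi ->
    preimage_set_system setT (EE phi t) (@borel R) `<=` past_sigma t ;
  ce_tower : forall t s phi, t < s -> usab full_sigma phi ->
    EE (EE phi s) t = EE phi t ;
  ce_cont_above : forall t (phi_ : nat -> Omega -> R) phi,
    (forall n, Cb (phi_ n)) -> usab full_sigma phi ->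
    decreases_to phi_ phi ->
    decreases_to (fun n => EE (phi_ n) t) (EE phi t) ;
  ce_cont_below : forall t (phi_ : nat -> Omega -> R) phi,
    (forall n, usab full_sigma (phi_ n)) -> usab full_sigma phi ->
    increases_to phi_ phi ->
    increases_to (fun n => EE (phi_ n) t) (EE phi t)
}.

(* The event that X_s differs from its left limit X_(s-). *)
Definition jump_at (s : R) : set Omega :=
  [set w | exists2 l : E, X r w @[r --> s^'-] --> l & X s w <> l].

Definition no_fixed_discontinuity (EE : (Omega -> R) -> R -> Omega -> R) :
    Prop :=
  forall (t : R) (w : Omega) (s a : R), t < s -> 0 < a ->
    EE (fun w' => a * \1_(jump_at s) w') t w = 0.

End ConvexExpectations.

(* Main.v *)
Require Import Defs.
From mathcomp Require Import all_boot all_order all_algebra.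
From mathcomp Require Import all_classical all_reals all_analysis.
From mathcomp Require Import lra ring.

Set Implicit Arguments.
Unset Strict Implicit.
Unset Printing Implicit Defensive.

Import Order.TTheory GRing.Theory Num.Theory.
Import numFieldNormedType.Exports.

Local Open Scope classical_set_scope.
Local Open Scope ring_scope.

(** The argument fixes [t] and a path [w] and works with the two functionals
    [phi |-> EE phi t w] and [phi |-> EEhat phi t w].  Such a functional is
    monotone, convex and preserves constants, which already yields a
    perturbation bound ([ce_perturb]): adding [psi] to a function bounded by
    [M] changes the value by at most [d] as soon as the functional is at most 1
    on a large multiple of [psi], where the multiple depends on [M] and [d]
    only.  Applied to multiples of the indicator of a past event that excludes
    [w], it shows that the value at [w] does not see what happens on this event
    ([ce_local]); a function of finitely many coordinates may thus have its
    coordinates before [t] replaced by those of [w], and becomes an element of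
    [cylinder_after].

    To go from cylinder functions to functions of the whole path, paths are
    compared through the Hausdorff distance of their graphs ([graph_dist]).  It
    is coarser than both path topologies, so a bounded Lipschitz function for
    it is continuous and bounded on the path space.  It is still fine enough for
    the coordinates to be measurable: the event that [X_s] lies in an open set
    is a countable union of graph-closed sets.  Moreover resampling a path on a
    fine grid moves it by little, uniformly for all paths near a given cadlag
    one ([graph_dist_resample]); this holds because a cadlag path stays close
    to each of its values on an interval of a fixed length.  By this local
    uniformity, if [f] is Lipschitz, [f_n] its resampled version and [h_n] the
    supremum over [m >= n] of [|f_m - f|], the sup-convolutions
    [x |-> sup_y (h_n y - n * graph_dist x y)] are Lipschitz and decrease to 0
    at every path of the space.  Continuity from above makes them negligible for
    both functionals, and the perturbation bound carries the inequality from
    the cylinder functions [f_n] to [f] ([compare_bounded_lip]).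

    The last step is the capacitability argument of Choquet, run for both
    functionals at once ([compare_layers]).  A bounded upper semianalytic
    function is a uniform limit of finite sums of indicators of analytic sets,
    and every set that is analytic over the coordinate sigma-algebra is analytic
    over graph-closed sets ([full_sigma_analytic]).  Continuity from below of
    [EE] bounds the branches of the Suslin schemes at a small loss; the
    bounded branches of length [k] form a graph-closed set, and by Koenig's
    lemma these sets decrease to a subset of the analytic set.  They are
    dominated by Lipschitz functions with the same limit, on which the
    inequality holds, and continuity from above of [EEhat] concludes. *)

(** * The Suslin operation *)

Section Suslin.
Context {T : Type}.
Implicit Types (G : set_system T) (A : set T).

(** The explicit pairing [2^k (2j+1) - 1] is used because it is monotone in [j]
    and at least [k]: the data coded by the first [l+1] entries of a sequence
    then determine every prefix needed at step [l]. *)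
Definition pair_code (k j : nat) : nat := (2 ^ k * j.*2.+1).-1.
Definition pair_dec (l : nat) : nat * nat :=
  (logn 2 l.+1, (l.+1 %/ 2 ^ logn 2 l.+1)./2).

Lemma pair_codeK k j : pair_dec (pair_code k j) = (k, j).
Proof.
have h : (pair_code k j).+1 = (2 ^ k * j.*2.+1)%N.
  by rewrite /pair_code prednK // muln_gt0 expn_gt0.
have lg : logn 2 (pair_code k j).+1 = k.
  rewrite h lognM ?expn_gt0 // lognX logn_prime //= muln1 lognE /=.
  by rewrite dvdn2 /= odd_double /= addn0.
by rewrite /pair_dec lg h mulKn ?expn_gt0 // -[in RHS](uphalf_double j).
Qed.

Lemma leq_pair_code k j : (k <= pair_code k j)%N.
Proof.
rewrite /pair_code -ltnS prednK ?muln_gt0 ?expn_gt0 //.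
by rewrite (leq_trans (ltn_expl k (ltnSn 1))) // leq_pmulr.
Qed.

Lemma leq_pair_code2 k j' j : (j' <= j)%N -> (pair_code k j' <= pair_code k j)%N.
Proof.
by move=> jj; rewrite /pair_code -!subn1 leq_sub2r // leq_mul2l ltnS leq_double jj orbT.
Qed.

(** A Suslin scheme is the same thing as a sequence of sets depending on a
    sequence [p], the [l]-th one through [p 0, ..., p l] only; this form spares
    the bookkeeping of prefixes. *)
Lemma analytic_scheme G (S : nat -> (nat -> nat) -> set T) :
  (forall l p, G (S l p)) ->
  (forall l p q, (forall i, (i <= l)%N -> p i = q i) -> S l p = S l q) ->
  analytic G [set x | exists p, forall l, S l p x].
Proof.
move=> GS ext.
exists (fun s => S (size s).-1 (nth 0 s)) => //.
have E n k : S (size (mkseq n k.+1)).-1 (nth 0 (mkseq n k.+1)) = S k n.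
  by rewrite size_mkseq; apply: ext => i ik; rewrite nth_mkseq.
apply/seteqP; split=> [x [p h]|x [p _ h]].
  by exists p => // k _ /=; rewrite E.
by exists p => l; have := h l I; rewrite E.
Qed.

Lemma mkseq_ext (p q : nat -> nat) k :
  (forall i, (i < k)%N -> p i = q i) -> mkseq p k = mkseq q k.
Proof.
move=> pq; apply: (@eq_from_nth _ 0%N); rewrite ?size_mkseq // => i ik.
by rewrite !nth_mkseq // pq.
Qed.

Lemma pair_decK l : pair_code (pair_dec l).1 (pair_dec l).2 = l.
Proof.
rewrite /pair_dec /pair_code /=; set k := logn 2 l.+1.
have d : (2 ^ k %| l.+1)%N by rewrite pfactor_dvdn.
have o : odd (l.+1 %/ 2 ^ k).
  apply/negPn/negP => ev.
  have : (2 ^ k.+1 %| l.+1)%N.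
    by rewrite -(divnK d) expnS dvdn_pmul2r ?expn_gt0 // dvdn2.
  by rewrite pfactor_dvdn // ltnn.
have -> : (l.+1 %/ 2 ^ k)./2.*2.+1 = (l.+1 %/ 2 ^ k)%N.
  by rewrite -[RHS]odd_double_half o.
by rewrite mulnC divnK.
Qed.

(** One sequence [p] encodes the sequence [n] chosen for the outer scheme and
    the sequences [m k] chosen for the inner schemes of its prefixes: the entry
    of index [pair_code k j] carries [m k j] in its second component, the entry
    of index [i] carries [n i] in its first.  Countable unions and
    intersections are special Suslin schemes, so closure under them follows. *)
Lemma analytic_idem G A : analytic (analytic G) A -> analytic G A.
Proof.
move=> [S hS ->].
have /choice [U hU] : forall s, exists U : seq nat -> set T,
    (forall u, G (U u)) /\
    S s = \bigcup_(n in setT) \bigcap_(k in setT) U (mkseq n k.+1).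
  by move=> s; have [U h1 h2] := hS s; exists U.
pose mu (p : nat -> nat) k j := (pair_dec (p (pair_code k j))).2.
pose nu (p : nat -> nat) i := (pair_dec (p i)).1.
pose V l p := U (mkseq (nu p) (pair_dec l).1.+1)
                (mkseq (mu p (pair_dec l).1) (pair_dec l).2.+1).
rewrite [X in analytic _ X](_ : _ = [set x | exists p, forall l, V l p x]).
  apply: analytic_scheme => [l p|l p q pq]; first exact: (hU _).1.
  rewrite /V; congr (U _ _); apply: mkseq_ext => i ik.
    by rewrite /nu pq // -[l in (_ <= l)%N]pair_decK (leq_trans _ (leq_pair_code _ _)).
  by rewrite /mu pq // -[l in (_ <= l)%N]pair_decK leq_pair_code2.
apply/seteqP; split=> x.
  move=> [n _ h].
  have /choice [m hm] : forall k, exists m, forall j,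
      U (mkseq n k.+1) (mkseq m j.+1) x.
    move=> k; have := h k I; have [_ ->] := hU (mkseq n k.+1).
    by move=> [m _ hm]; exists m => j; exact: hm.
  pose p i := pair_code (n i) (m (pair_dec i).1 (pair_dec i).2).
  exists p => l; rewrite /V.
  rewrite (@mkseq_ext (nu p) n); last by move=> i _; rewrite /nu pair_codeK.
  rewrite (@mkseq_ext (mu p _) (m (pair_dec l).1)) //.
  by move=> i _; rewrite /mu !pair_codeK.
move=> [p hp]; exists (nu p) => // k _ /=.
have [_ ->] := hU (mkseq (nu p) k.+1).
exists (mu p k) => // j _ /=.
by have := hp (pair_code k j); rewrite /V pair_codeK.
Qed.

Lemma sub_analytic G A : G A -> analytic G A.
Proof.
move=> GA; exists (fun=> A) => //; apply/seteqP; split => [x Ax|x [p _ /(_ 0%N I)]//].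
by exists (fun=> 0%N).
Qed.

Lemma analytic_mono G G' : G `<=` G' -> analytic G `<=` analytic G'.
Proof. by move=> GG A [S hS ->]; exists S => // s; exact/GG. Qed.

Lemma analytic_bigcup G (A : nat -> set T) :
  (forall i, analytic G (A i)) -> analytic G (\bigcup_i A i).
Proof.
move=> hA; apply: analytic_idem; exists (fun s => A (head 0%N s)) => [s|]; first exact: hA.
apply/seteqP; split => [x [i _ Ai]|x [p _ h]]; first by exists (fun=> i).
by exists (p 0%N) => //; exact: (h 0%N).
Qed.

Lemma analytic_bigcap G (A : nat -> set T) :
  (forall i, analytic G (A i)) -> analytic G (\bigcap_i A i).
Proof.
move=> hA; apply: analytic_idem; exists (fun s => A (size s).-1) => [s|]; first exact: hA.
apply/seteqP; split => [x h|x [p _ h] i _].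
  by exists (fun=> 0%N) => // k _; rewrite size_mkseq; exact: h.
by have := h i I; rewrite size_mkseq.
Qed.

Lemma analyticI G A B : analytic G A -> analytic G B -> analytic G (A `&` B).
Proof.
move=> hA hB; rewrite (_ : _ `&` _ = \bigcap_i (if i is 0 then A else B)).
  by apply: analytic_bigcap => -[|i].
apply/seteqP; split=> [x [Ax Bx] [|i] _ //|x h].
by split; [exact: (h 0%N)|exact: (h 1%N)].
Qed.

Lemma analytic_countable_bigcup (I : countType) G (P : I -> Prop) (A : I -> set T) :
  analytic G set0 -> (forall i, P i -> analytic G (A i)) ->
  analytic G (\bigcup_(i in [set i | P i]) A i).
Proof.
move=> h0 hA.
rewrite (_ : \bigcup_(i in _) _ = \bigcup_n
   (if unpickle n is Some i then (if pselect (P i) then A i else set0) else set0)).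
  apply: analytic_bigcup => n; case: unpickle => // i.
  by case: pselect => // Pi; exact: hA.
apply/seteqP; split=> [x [i Pi Ax]|x [n _]].
  by exists (pickle i) => //; rewrite pickleK; case: pselect.
by case: unpickle => // i; case: pselect => // Pi Ax; exists i.
Qed.

(** Dependent choice along the tree of finite sequences; it produces both the
    bounding sequence of the capacitability argument and the branch in
    Koenig's lemma. *)
Lemma prefix_choice (P : seq nat -> Prop) :
  P [::] -> (forall s, P s -> exists i, P (rcons s i)) ->
  exists p : nat -> nat, forall k, P (mkseq p k).
Proof.
move=> P0 PS.
have /choice [step hs] : forall s, exists i, P s -> P (rcons s i).
  move=> s; have [/PS [i Pi]|nP] := pselect (P s); first by exists i.
  by exists 0%N.
pose u k := iter k (fun s => rcons s (step s)) [::].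
exists (step \o u) => k.
have -> : mkseq (step \o u) k = u k.
  by elim: k => // k ih; rewrite mkseqS ih.
by elim: k => //= k; exact: hs.
Qed.

End Suslin.

(** * Upper semianalytic functions *)

Section Usab.
Context {R : realType} {T : Type}.

Lemma bounded_fun_ex (f : T -> R) :
  bounded_fun f <-> exists M, forall x, `|f x| <= M.
Proof.
split=> [[M [Mr hM]]|[M hM]].
  by exists (M + 1) => x; apply: (hM (M + 1)) => //; rewrite ltrDl.
exists M; split; first exact: num_real.
by move=> N MN x _; apply: le_trans (hM x) (ltW MN).
Qed.

Lemma bounded_funI (f : T -> R) M : (forall x, `|f x| <= M) -> bounded_fun f.
Proof. by move=> h; apply/bounded_fun_ex; exists M. Qed.

Context {G : set_system T} (G0 : G set0) (GT : G setT).

Lemma usab_bound (f : T -> R) : usab G f -> exists M, forall x, `|f x| <= M.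
Proof. by case=> /bounded_fun_ex. Qed.

Lemma usab_cst (c : R) : usab G (fun=> c).
Proof.
split; first by apply/bounded_fun_ex; exists `|c|.
move=> d; have [dc|dc] := leP d c.
  by rewrite (_ : [set _ | _] = setT); [exact: sub_analytic|apply/seteqP].
rewrite (_ : [set _ | _] = set0); first exact: sub_analytic.
by apply/seteqP; split.
Qed.

Lemma ler_sub_invn (x y : R) : (forall i : nat, x - i.+1%:R^-1 <= y) -> x <= y.
Proof.
move=> h; rewrite leNgt; apply/negP => /ltr_add_invr[k hk].
by have := h k; rewrite lerBlDr leNgt hk.
Qed.

(** [c <= f + g] says that for every [i] some rational [q <= f] leaves
    [g >= c - q - 1/(i+1)]: only countable operations on level sets occur. *)
Lemma usabD (f g : T -> R) : usab G f -> usab G g ->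
  usab G (fun x => f x + g x).
Proof.
move=> [bf af] [bg ag]; split.
  move: bf bg => /bounded_fun_ex[M hM] /bounded_fun_ex[N hN].
  apply/bounded_fun_ex; exists (M + N) => x.
  by rewrite (le_trans (ler_normD _ _)) // lerD.
move=> c.
rewrite (_ : [set x | _] = \bigcap_(i : nat) \bigcup_(q in [set q : rat | True])
  ([set x | ratr q <= f x] `&` [set x | c - ratr q - i.+1%:R^-1 <= g x])).
  apply: analytic_bigcap => i; apply: analytic_countable_bigcup => [|q _].
    exact: sub_analytic.
  exact: analyticI.
apply/seteqP; split=> x /=.
  move=> cfg i _; have : f x - i.+1%:R^-1 < f x by rewrite ltrBlDr ltrDl invr_gt0 ltr0n.
  move=> /rat_in_itvoo[q]; rewrite in_itv /= => /andP[q1 q2].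
  exists q => //; split=> /=; first exact: ltW.
  by move: (ratr q) (i.+1%:R^-1 : R) q1 q2 => r e q1 q2; lra.
move=> h; apply: ler_sub_invn => i; have [q _ [/= q1 q2]] := h i I.
by move: (ratr q) (i.+1%:R^-1 : R) q1 q2 => r e q1 q2; lra.
Qed.

Lemma usabZ (a : R) (f : T -> R) : 0 <= a -> usab G f ->
  usab G (fun x => a * f x).
Proof.
rewrite le_eqVlt => /predU1P[<- _|a0 [bf af]].
  by under eq_fun do rewrite mul0r; exact: usab_cst.
split.
  move: bf => /bounded_fun_ex[M hM]; apply/bounded_fun_ex; exists (a * M) => x.
  by rewrite normrM (gtr0_norm a0) ler_pM2l.
move=> c; rewrite (_ : [set _ | _] = [set x | c / a <= f x]) //.
by apply/funext => x /=; rewrite ler_pdivrMr // mulrC.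
Qed.

Lemma usab_sum (J : nat) (f : nat -> T -> R) :
  (forall j, usab G (f j)) -> usab G (fun x => \sum_(j < J) f j x).
Proof.
move=> hf; elim: J => [|J ih].
  by under eq_fun do rewrite big_ord0; exact: usab_cst.
by under eq_fun do rewrite big_ord_recr; exact: usabD.
Qed.

Lemma usab_indic (a : R) (A : set T) : 0 <= a -> analytic G A ->
  usab G (fun x => a * \1_A x).
Proof.
move=> a0 hA; apply: usabZ => //; split.
  apply/bounded_fun_ex; exists 1 => x.
  by rewrite indicE; case: (_ \in _); rewrite ?normr1 ?normr0.
move=> c.
have [c0|c0] := leP c 0.
  rewrite (_ : [set _ | _] = setT); first exact: sub_analytic.
  by apply/seteqP; split => // x _ /=; rewrite (le_trans c0) // indicE.
have [c1|c1] := leP c 1.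
  rewrite (_ : [set _ | _] = A) //; apply/seteqP; split => x /=.
    rewrite indicE; case: (boolP (x \in A)) => [|_ c0']; first by rewrite inE.
    by move: c0; rewrite ltNge c0'.
  by move=> Ax; rewrite indicE mem_set.
rewrite (_ : [set _ | _] = set0); first exact: sub_analytic.
apply/seteqP; split => // x /=; rewrite indicE => /(lt_le_trans c1).
by case: (_ \in _); rewrite ?ltxx // ltNge ler01.
Qed.

Lemma usab_lim (f : nat -> T -> R) (g : T -> R) :
  (forall n, usab G (f n)) -> bounded_fun g ->
  (forall x, f ^~ x @ \oo --> g x) -> usab G g.
Proof.
move=> hf bg fg; split=> // c.
rewrite (_ : [set x | _] = \bigcap_(i : nat) \bigcup_(n : nat) \bigcap_(m : nat)
  [set x | c - i.+1%:R^-1 <= f (n + m)%N x]).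
  apply: analytic_bigcap => i; apply: analytic_bigcup => n.
  by apply: analytic_bigcap => m; have [_] := hf (n + m)%N.
apply/seteqP; split=> x /=.
  move=> cg i _; have i0 : 0 < i.+1%:R^-1 :> R by rewrite invr_gt0 ltr0n.
  have /cvgrPdist_lt/(_ _ i0)[n _ hn] := fg x.
  exists n => // m _ /=; have := hn (n + m)%N (leq_addr _ _).
  by move: i0 => _; rewrite /= ltr_norml => /andP[_]; move: (i.+1%:R^-1 : R) => e; lra.
move=> h; apply: ler_sub_invn => i; have [n _ hn] := h i I.
apply: (cvgr_to_ge (fg x)).
exists n => // m /= nm; have := hn (m - n)%N I.
by rewrite /= subnKC.
Qed.

End Usab.

Lemma usab_mono (R : realType) (T : Type) (G G' : set_system T) (f : T -> R) :
  G `<=` G' -> usab G f -> usab G' f.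
Proof. by move=> GG [bf af]; split=> // c; apply: analytic_mono (af c). Qed.

(** * A graph distance between paths *)

Section GraphDist.
Context {R : realType} {E : metricType R}.
Implicit Types (x y z : R -> E) (e : R).

(** Every point of the graph of [x] over the window [-1/e, 1/e] is within [e] of
    the graph of [y].  No monotone time change relates the two paths. *)
Definition graph_near e x y : Prop :=
  forall s, `|s| <= e^-1 -> exists2 u, `|u - s| < e & mdist (x s) (y u) < e.

Definition graph_close e x y : Prop := graph_near e x y /\ graph_near e y x.

(** The truncation at 1 is what makes the triangle inequality compatible with
    the window of width [1/e]. *)
Definition graph_dist x y : R :=
  inf [set e | 0 < e /\ (1 <= e \/ graph_close e x y)].

Lemma graph_near_le e e' x y : 0 < e -> e <= e' ->
  graph_near e x y -> graph_near e' x y.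
Proof.
move=> e0 ee h s se; have [|u us d] := h s.
  by rewrite (le_trans se) // lef_pV2 // posrE (lt_le_trans e0).
by exists u; exact: lt_le_trans ee.
Qed.

Lemma graph_dist_le1 x y : graph_dist x y <= 1.
Proof. by apply: ge_inf; [exists 0 => e [/ltW]|split => //; left]. Qed.

Lemma graph_dist_le e x y : 0 < e -> graph_close e x y -> graph_dist x y <= e.
Proof. by move=> e0 h; apply: ge_inf; [exists 0 => a [/ltW]|split => //; right]. Qed.

Lemma graph_dist_ge0 x y : 0 <= graph_dist x y.
Proof. by apply: lb_le_inf; [exists 1; split => //; left|move=> e [/ltW]]. Qed.

Lemma graph_dist_lt e x y : graph_dist x y < e -> e <= 1 -> graph_close e x y.
Proof.
move=> /inf_lt[|a [a0 ha] ae e1]; first by exists 1; split => //; left.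
case: ha => [|[h1 h2]]; first by rewrite leNgt (lt_le_trans ae e1).
by split; apply: graph_near_le (ltW ae) _.
Qed.

Lemma graph_dist_sym x y : graph_dist x y = graph_dist y x.
Proof.
by rewrite /graph_dist; congr inf; apply/seteqP;
  split => e [e0 [|[h1 h2]]]; split => //; [left|right|left|right].
Qed.

(** A point matched at the first stage may leave the window by [a]; the bound
    [1/(a+b) + a <= 1/b], valid since [b (a+b) <= 1], keeps it inside the
    window of the second stage. *)
Lemma graph_near_comp a b x y z : 0 < a -> 0 < b -> a + b < 1 ->
  graph_near a x y -> graph_near b y z -> graph_near (a + b) x z.
Proof.
move=> a0 b0 ab xy yz s se.
have ab0 : 0 < a + b by exact: addr_gt0.
have [|u us d] := xy s.
  by rewrite (le_trans se) // lef_pV2 ?posrE // lerDl ltW.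
have [|v vu d'] := yz u.
  have ua : `|u| <= a + (a + b)^-1.
    by rewrite -(subrK s u) (le_trans (ler_normD _ _)) // lerD // ltW.
  rewrite (le_trans ua) // -subr_ge0.
  have -> : b^-1 - (a + (a + b)^-1) = a / (b * (a + b)) * (1 - b * (a + b)).
    by field; rewrite !gt_eqF //.
  have b1 : b <= 1 by lra.
  apply: mulr_ge0; first exact: ltW (divr_gt0 a0 (mulr_gt0 b0 ab0)).
  by rewrite subr_ge0 mulr_ile1 // ltW.
exists v.
  rewrite -(subrK u v) -addrA; apply: le_lt_trans (ler_normD _ _) _.
  by rewrite (addrC a) ltrD.
by apply: le_lt_trans (metric_triangle _ (y u) _) _; rewrite ltrD.
Qed.

Lemma graph_dist_triangle x y z :
  graph_dist x z <= graph_dist x y + graph_dist y z.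
Proof.
apply/ler_addgt0Pl => e e0.
set a := graph_dist x y; set b := graph_dist y z.
have a0 : 0 <= a by exact: graph_dist_ge0.
have b0 : 0 <= b by exact: graph_dist_ge0.
have [ab|ab] := leP 1 (e + (a + b)); first exact: le_trans (graph_dist_le1 _ _) ab.
have ae : a < a + e / 2 by rewrite ltrDl divr_gt0.
have be : b < b + e / 2 by rewrite ltrDl divr_gt0.
have [|h1 h2] := graph_dist_lt ae; first by lra.
have [|h3 h4] := graph_dist_lt be; first by lra.
have -> : e + (a + b) = (a + e / 2) + (b + e / 2) by field.
apply: graph_dist_le; first by lra.
split; first by apply: graph_near_comp h1 h3; lra.
by rewrite addrC; apply: graph_near_comp h4 h2; lra.
Qed.

Lemma graph_dist_unif e x y : 0 < e -> (forall s, mdist (x s) (y s) < e) ->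
  graph_dist x y <= e.
Proof.
move=> e0 h; apply: graph_dist_le => //.
by split => s _; exists s; rewrite ?subrr ?normr0 // metric_sym.
Qed.

Lemma graph_distxx x : graph_dist x x = 0.
Proof.
apply/eqP; rewrite eq_le graph_dist_ge0 andbT; apply/ler_addgt0Pl => e e0.
by rewrite addr0; apply: graph_dist_unif => // s; rewrite mdistxx.
Qed.

Definition bounded_lip (f : (R -> E) -> R) : Prop :=
  (exists M, forall x, `|f x| <= M) /\
  (exists2 L, 0 < L & forall x y, `|f x - f y| <= L * graph_dist x y).

Lemma bounded_lip_cst c : bounded_lip (fun=> c).
Proof.
split; first by exists `|c|.
by exists 1 => // x y; rewrite subrr normr0 mul1r graph_dist_ge0.
Qed.

Lemma bounded_lipD f g : bounded_lip f -> bounded_lip g ->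
  bounded_lip (fun x => f x + g x).
Proof.
move=> [[M hM] [L L0 hL]] [[N hN] [K K0 hK]]; split.
  by exists (M + N) => x; rewrite (le_trans (ler_normD _ _)) // lerD.
exists (L + K); first exact: addr_gt0.
move=> x y; rewrite mulrDl opprD addrACA (le_trans (ler_normD _ _)) //.
by rewrite lerD.
Qed.

Lemma bounded_lipZ a f : bounded_lip f -> bounded_lip (fun x => a * f x).
Proof.
move=> [[M hM] [L L0 hL]]; split.
  by exists (`|a| * M) => x; rewrite normrM ler_wpM2l.
exists ((`|a| + 1) * L); first by rewrite mulr_gt0 // ltr_wpDl.
move=> x y; rewrite -mulrBr normrM -mulrA.
by rewrite ler_pM // lerDl.
Qed.

Lemma bounded_lip_sum J (f : nat -> (R -> E) -> R) : (forall j, bounded_lip (f j)) ->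
  bounded_lip (fun x => \sum_(j < J) f j x).
Proof.
move=> hf; elim: J => [|J ih].
  by under eq_fun do rewrite big_ord0; exact: bounded_lip_cst.
by under eq_fun do rewrite big_ord_recr; exact: bounded_lipD.
Qed.

Section SupConv.
Context (M : R) (Q : nat -> (R -> E) -> R -> Prop).
Hypothesis Q0 : forall n x, Q n x 0.
Hypothesis QM : forall n x v, Q n x v -> 0 <= v <= M.
Hypothesis Qmono : forall n x v, Q n.+1 x v -> Q n x v.

(** The datum [Q n y v] reads as: [v] is one of the values attached to [y] at
    stage [n].  Regularising a multivalued function covers in one stroke the
    errors [|f_m - f|], [m >= n], and the indicators of decreasing sets. *)
Definition sup_conv (n : nat) (x : R -> E) : R :=
  sup [set a | exists y v, Q n y v /\ a = v - n.+1%:R * graph_dist x y].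

Let sup_conv_ub n x : has_ubound [set a | exists y v, Q n y v /\
  a = v - n.+1%:R * graph_dist x y].
Proof.
exists M => a [y [v [Qv ->]]]; have /andP[_ vM] := QM Qv.
by rewrite lerBlDr (le_trans vM) // lerDl mulr_ge0 // graph_dist_ge0.
Qed.

Lemma sup_conv_ge n x v : Q n x v -> v <= sup_conv n x.
Proof.
move=> Qv; apply: ub_le_sup; first exact: sup_conv_ub.
by exists x, v; split => //; rewrite graph_distxx mulr0 subr0.
Qed.

Lemma sup_conv_le n x b : (forall y v, Q n y v -> v - n.+1%:R * graph_dist x y <= b) ->
  sup_conv n x <= b.
Proof.
move=> h; apply: ge_sup; first by exists (0 - n.+1%:R * graph_dist x x), x, 0.
by move=> a [y [v [Qv ->]]]; exact: h.
Qed.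

Lemma sup_conv_ge0 n x : 0 <= sup_conv n x.
Proof. exact: sup_conv_ge. Qed.

Lemma sup_conv_leM n x : sup_conv n x <= M.
Proof.
apply: sup_conv_le => y v /QM/andP[_ vM].
by rewrite lerBlDr (le_trans vM) // lerDl mulr_ge0 // graph_dist_ge0.
Qed.

Lemma sup_conv_lip n x y : sup_conv n x <= sup_conv n y + n.+1%:R * graph_dist x y.
Proof.
apply: sup_conv_le => z v Qv.
have : v - n.+1%:R * graph_dist y z <= sup_conv n y.
  by apply: ub_le_sup; [exact: sup_conv_ub|exists z, v].
have := graph_dist_triangle y x z; rewrite (graph_dist_sym y x).
by move: (n.+1%:R : R) (ltr0Sn R n) => k k0 h1 h2; nra.
Qed.

Lemma sup_conv_bounded_lip n : bounded_lip (sup_conv n).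
Proof.
split; first by exists M => x; rewrite ger0_norm ?sup_conv_ge0 ?sup_conv_leM.
exists n.+1%:R => // x y; rewrite ler_norml.
have := sup_conv_lip n x y; have := sup_conv_lip n y x.
by rewrite (graph_dist_sym y x); lra.
Qed.

Lemma sup_conv_nonincreasing x : nonincreasing_seq (sup_conv ^~ x).
Proof.
apply/nonincreasing_seqP => n; apply: sup_conv_le => y v /Qmono Qv.
apply: (@le_trans _ _ (v - n.+1%:R * graph_dist x y)).
  by rewrite lerB // ler_wpM2r ?graph_dist_ge0 // ler_nat.
by apply: ub_le_sup; [exact: sup_conv_ub|exists y, v].
Qed.

(** Points at distance at least [r] from [x] are eliminated by the penalty once
    [n r] exceeds the bound [M], so only the values near [x] survive. *)
Lemma sup_conv_cvg x (l : R) : 0 <= l -> (forall n, l <= sup_conv n x) ->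
  (forall e, 0 < e -> exists n, exists2 r, 0 < r & forall y v,
      graph_dist x y < r -> Q n y v -> v <= l + e) ->
  sup_conv ^~ x @ \oo --> l.
Proof.
move=> l0 lx h; apply/cvgrPdist_le => e e0.
have [n [r r0 hn]] := h e e0.
have Qle m k y v : (m <= k)%N -> Q k y v -> Q m y v.
  move=> /subnK <-; elim: (k - m)%N => // i ih; rewrite addSn => /Qmono; exact: ih.
exists (maxn n (Num.truncn (M / r))) => // m /=; rewrite geq_max => /andP[nm rm].
rewrite distrC ger0_norm ?subr_ge0 // lerBlDl; apply: sup_conv_le => y v Qv.
have [xy|xy] := ltP (graph_dist x y) r.
  have := hn _ _ xy (Qle _ _ _ _ nm Qv).
  rewrite lerBlDr => /le_trans; apply.
  by rewrite lerDl mulr_ge0 // graph_dist_ge0.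
have /andP[_ vM] := QM Qv.
rewrite lerBlDr (le_trans vM) //.
have : M <= m.+1%:R * graph_dist x y.
  rewrite (@le_trans _ _ (m.+1%:R * r)) ?ler_pM2l //.
  by rewrite -ler_pdivrMr // ltW // (lt_le_trans (truncnS_gt _)) // ler_nat.
by lra.
Qed.

End SupConv.

End GraphDist.

(** * Resampling paths near a cadlag path *)

Section Cadlag.
Context {R : realType} {E : metricType R}.
Implicit Types (x y z : R -> E) (e : R).

Lemma cvg_right_mdist x (t : R) (l : E) e : x r @[r --> t^'+] --> l -> 0 < e ->
  exists2 d, 0 < d & forall u, t < u -> u < t + d -> mdist l (x u) < e.
Proof.
move=> /metricType_numDomainType.cvgr_dist_lt h e0.
have /nbhs_ballP[d d0 hd] := h e e0; exists d => // u tu ud.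
by apply: hd => //; rewrite /ball /= ltr0_norm; lra.
Qed.

Lemma cvg_left_mdist x (t : R) (l : E) e : x r @[r --> t^'-] --> l -> 0 < e ->
  exists2 d, 0 < d & forall u, u < t -> t - d < u -> mdist l (x u) < e.
Proof.
move=> /metricType_numDomainType.cvgr_dist_lt h e0.
have /nbhs_ballP[d d0 hd] := h e e0; exists d => // u tu ud.
by apply: hd => //; rewrite /ball /= gtr0_norm; lra.
Qed.

Lemma mdist_near (l a b : E) e : mdist l a < e / 2 -> mdist l b < e / 2 ->
  mdist a b < e.
Proof.
move=> la lb; apply: le_lt_trans (metric_triangle _ l _) _.
by rewrite (metric_sym a) (splitr e) ltrD.
Qed.

(** Near a point [a] the path is close to [x a] on the right and to its left
    limit on the left, so each value nearby is nearly repeated on a whole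
    one-sided neighbourhood; compactness makes the length uniform. *)
Lemma cadlag_plateau x e (M : R) : cadlag x -> 0 < e ->
  exists2 d, 0 < d & forall s, `|s| <= M ->
    exists2 c, `|c - s| < e & forall u, `|u - c| < d -> mdist (x u) (x s) < e.
Proof.
move=> cx e0.
pose P (d s : R) := exists2 c, `|c - s| < e &
  forall u, `|u - c| < d -> mdist (x u) (x s) < e.
have /compact_near_coveringP/(_ R (0^'+) P) : compact `[- M, M].
  exact: segment_compact.
case.
- move=> a _; have [ra [l la]] := cx a.
  have e20 : 0 < e / 2 by lra.
  have [d1 d10 h1] := cvg_right_mdist ra e20.
  have [d2 d20 h2] := cvg_left_mdist la e20.
  pose d := Num.min e (Num.min d1 d2).
  have d0 : 0 < d by rewrite !lt_min e0 d10.
  have de : d <= e by rewrite ge_min lexx.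
  have dd1 : d <= d1 by rewrite !ge_min lexx orbT.
  have dd2 : d <= d2 by rewrite !ge_min lexx !orbT.
  exists (ball a d, [set r | 0 < r < d / 2]) => /=.
    split; first exact: nbhsx_ballx.
    have d20' : 0 < d / 2 by lra.
    apply/nbhs_ballP; exists (d / 2) => // u; rewrite /ball /= sub0r normrN => ud u0.
    by rewrite u0 /=; apply: le_lt_trans (ler_norm _) ud.
  move=> [s r] /= [+ /andP[r0 rd]]; rewrite /ball /= ltr_norml => /andP[as1 as2].
  have [sa|sa] := leP a s.
    exists (a + d / 2); first by rewrite ltr_norml; lra.
    move=> u; rewrite ltr_norml => /andP[u1 u2].
    apply: (@mdist_near (x a)); first by apply: h1; lra.
    move: sa; rewrite le_eqVlt => /predU1P[<-|sa]; first by rewrite mdistxx.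
    by apply: h1; lra.
  exists (a - d / 2); first by rewrite ltr_norml; lra.
  move=> u; rewrite ltr_norml => /andP[u1 u2].
  by apply: (@mdist_near l); apply: h2; lra.
- move=> d /= d0 hd.
  have d20 : 0 < d / 2 by lra.
  exists (d / 2) => // s sM; apply: (hd (d / 2)) => //=.
    by rewrite sub0r normrN gtr0_norm //; lra.
  by rewrite in_itv /= -ler_norml.
Qed.

(** A value [y s] is close to some [x s1]; by [cadlag_plateau] the value [x s1]
    is nearly constant on an interval around some [c], and the graph of [y]
    above that interval, in particular [y (tau c)], stays close to it.  Only
    the limit path [x] has to be cadlag. *)
Lemma graph_dist_resample x e : cadlag x -> 0 < e ->
  exists2 d, 0 < d & forall y (tau : R -> R), graph_dist x y < d ->
    (forall s, `|s| <= d^-1 -> `|tau s - s| < d) -> graph_dist (y \o tau) y <= e.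
Proof.
move=> cx e0.
(* At most three errors below [e'] add up; [e' <= 1/4] keeps [d] below the
   truncation level of [graph_dist]. *)
pose e' := Num.min e 1 / 4.
have e'0 : 0 < e' by rewrite divr_gt0 // lt_min e0 /=.
have e'e : e' * 4 <= e by rewrite mulfVK // ge_min lexx.
have e'1 : e' * 4 <= 1 by rewrite mulfVK // ge_min lexx orbT.
have [r r0 hr] := cadlag_plateau (e^-1 + 2) cx e'0.
(* Two shifts by less than [d] stay within the plateau of half-length [r], and all
   times involved stay in the window of half-width [e^-1 + 3]. *)
pose d := Num.min (r / 3) (Num.min e' (e^-1 + 3)^-1).
have eV0 : 0 < e^-1 by rewrite invr_gt0.
have d0 : 0 < d by rewrite !lt_min divr_gt0 //= e'0 invr_gt0; lra.
have dr : d <= r / 3 by rewrite ge_min lexx.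
have de : d <= e' by rewrite !ge_min lexx orbT.
have dV : e^-1 + 3 <= d^-1.
  rewrite -[leLHS]invrK lef_pV2 ?posrE // ?invr_gt0; last by lra.
  by rewrite !ge_min lexx !orbT.
exists d => // y tau xy ht.
have [xyn yxn] : graph_close d x y by apply: graph_dist_lt => //; lra.
apply: graph_dist_le => //; split=> s sV.
  exists (tau s); last by rewrite mdistxx.
  by apply: lt_le_trans (ht _ _) _; lra.
have [|s1 s1s ys] := yxn s; first by lra.
have s1V : `|s1| <= e^-1 + 2.
  by have := ler_normD (s1 - s) s; rewrite subrK; lra.
have [c cs hc] := hr s1 s1V.
have cV : `|c| <= d^-1.
  by have := ler_normD (c - s1) s1; rewrite subrK; lra.
have tc := ht c cV.
have [|u uc yu] := yxn (tau c).
  have := ler_normD (s1 - s) s; have := ler_normD (c - s1) s1.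
  by have := ler_normD (tau c - c) c; rewrite !subrK; lra.
exists c.
  by have := ler_normD (c - s1) (s1 - s); rewrite addrA subrK; lra.
have ucr : `|u - c| < r.
  by have := ler_normD (u - tau c) (tau c - c); rewrite addrA subrK; lra.
have := hc u ucr; rewrite (metric_sym _ (x s1)) => xu.
have := metric_triangle (y s) (x s1) (y (tau c)).
have := metric_triangle (x s1) (x u) (y (tau c)).
by rewrite (metric_sym (x u) (y _)) /=; lra.
Qed.

End Cadlag.

(** * Sets and functions determined by finitely many times *)

Section GeneratedSigma.
Context {T : Type} (G : set_system T).

Lemma generated0 : <<s G >> set0.
Proof. exact: sigma_algebra0. Qed.

Lemma generatedC A : <<s G >> A -> <<s G >> (~` A).
Proof. by move=> h; rewrite -setTD; exact: sigma_algebraCD. Qed.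

Lemma generatedT : <<s G >> setT.
Proof. by have := generatedC generated0; rewrite setC0. Qed.

Lemma generated_bigcap (A : nat -> set T) :
  (forall i, <<s G >> (A i)) -> <<s G >> (\bigcap_i A i).
Proof.
move=> h; rewrite -[X in <<s _ >> X]setCK setC_bigcap.
apply: generatedC; apply: sigma_algebra_bigcup => i.
exact: generatedC.
Qed.

Lemma generated_countable_bigcup (I : countType) (P : I -> Prop) (A : I -> set T) :
  (forall i, P i -> <<s G >> (A i)) -> <<s G >> (\bigcup_(i in [set i | P i]) A i).
Proof.
move=> hA; rewrite (_ : \bigcup_(i in _) _ = \bigcup_n
   (if unpickle n is Some i then (if pselect (P i) then A i else set0) else set0)).
  apply: sigma_algebra_bigcup => n; case: unpickle => [i|]; last exact: generated0.
  by case: pselect => Pi; [exact: hA|exact: generated0].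
apply/seteqP; split=> [x [i Pi Ax]|x [n _]].
  by exists (pickle i) => //; rewrite pickleK; case: pselect.
by case: unpickle => // i; case: pselect => // Pi Ax; exists i.
Qed.

End GeneratedSigma.

Section FiniteDim.
Context {R : realType} {E : metricType R} {Omega : topologicalType}.
Context (X : R -> Omega -> E).
Context (hsep : exists2 D : set E, countable D & dense D).

Definition near_at (ts : seq R) (e : R) (w w' : Omega) : Prop :=
  forall s, s \in ts -> mdist (X s w) (X s w') < e.

Lemma dense_seq (x0 : E) : exists dn : nat -> E, forall x e, 0 < e ->
  exists n, mdist x (dn n) < e.
Proof.
have [D /countable_injP[f finj] dD] := hsep.
exists (fun n => xget x0 [set y | D y /\ f y = n]) => x e e0.
have [|y [/= /interior_subset]] := dD (ball x e)^° _ (@open_interior _ _).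
  by exists x; apply: nbhsx_ballx.
rewrite ballEmdist /= => xy Dy; exists (f y).
case: xgetP => [z _ [Dz fz]|/(_ y)]; last by case.
by rewrite (finj z y) // inE.
Qed.

Lemma coord_ball_sigma (J : set R) s (x : E) e : J s ->
  coord_sigma X J [set w | mdist (X s w) x < e].
Proof.
move=> Is; apply: sub_sigma_algebra; exists s => //.
exists [set y | mdist y x < e]; last by rewrite setTI.
apply: sub_sigma_algebra; rewrite openE => y /= yx.
apply/nbhs_ballP; exists (e - mdist y x) => /=; first by rewrite subr_gt0.
move=> z; rewrite ballEmdist /= => yz.
by have := metric_triangle z y x; rewrite (metric_sym z y); lra.
Qed.

(** A set that is open in finitely many coordinates is a countable union of
    products of balls with centres in a dense sequence and radii [1/(k+1)]. *)
Lemma fd_open_sigma (J : set R) (ts : seq R) (A : set Omega) :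
  (forall s, s \in ts -> J s) ->
  (forall w, A w -> exists2 e, 0 < e & forall w', near_at ts e w w' -> A w') ->
  coord_sigma X J A.
Proof.
move=> tsJ hA.
have [->|/set0P[w0 _]] := eqVneq A set0; first exact: generated0.
have [dn hdn] := dense_seq (X 0 w0).
pose K (p : seq nat * nat) := \bigcap_i [set w | (i < size ts)%N ->
  mdist (X (nth 0 ts i) w) (dn (nth 0%N p.1 i)) < p.2.+1%:R^-1].
rewrite (_ : A = \bigcup_(p in [set p | K p `<=` A]) K p); last first.
  apply/seteqP; split=> [w Aw|w [p pA]]; last exact: pA.
  have [e e0 he] := hA w Aw.
  have [k] : exists k, 0 + k.+1%:R^-1 < e / 2 :> R by apply: ltr_add_invr; lra.
  rewrite add0r => ke.
  have k0 : 0 < k.+1%:R^-1 :> R by rewrite invr_gt0.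
  have /choice[c hc] : forall i, exists n,
      mdist (X (nth 0 ts i) w) (dn n) < k.+1%:R^-1 by move=> i; exact: hdn.
  have cE i : (i < size ts)%N -> nth 0%N (mkseq c (size ts)) i = c i.
    by move=> its; rewrite nth_mkseq.
  exists (mkseq c (size ts), k); last by move=> i _ /= its; rewrite cE.
  move=> w' /= hw'; apply: he => s /(nthP 0)[i its <-].
  have /= := hw' i I its; rewrite cE // => h1.
  have := metric_triangle (X (nth 0 ts i) w) (dn (c i)) (X (nth 0 ts i) w').
  rewrite (metric_sym (dn _)); move: h1 (hc i) ke.
  by move: (k.+1%:R^-1 : R) => a; lra.
apply: generated_countable_bigcup => p _; apply: generated_bigcap => i.
have [its|its] := boolP (i < size ts)%N.
  rewrite (_ : [set w | _] = [set w |
      mdist (X (nth 0 ts i) w) (dn (nth 0%N p.1 i)) < p.2.+1%:R^-1]).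
    by apply: coord_ball_sigma; apply: tsJ; exact: mem_nth.
  by apply/seteqP; split => w /=; [exact|].
rewrite (_ : [set w | _] = setT); first exact: generatedT.
by apply/seteqP; split.
Qed.

Lemma fd_usab (J : set R) (ts : seq R) (h : Omega -> R) :
  (forall s, s \in ts -> J s) -> bounded_fun h ->
  (forall w e, 0 < e -> exists2 d, 0 < d &
     forall w', near_at ts d w w' -> h w' < h w + e) ->
  usab (coord_sigma X J) h.
Proof.
move=> tsJ bh hh; split=> // c; apply: sub_analytic.
rewrite (_ : [set _ | _] = ~` [set w | h w < c]).
  apply: generatedC; apply: (fd_open_sigma tsJ) => w /= hw.
  have hc : 0 < c - h w by rewrite subr_gt0.
  have [d d0 hd] := hh w _ hc; exists d => // w' /hd.
  by rewrite addrC subrK.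
by apply/seteqP; split => w /=; rewrite leNgt => /negP.
Qed.

End FiniteDim.

Section Grid.
Context {R : realType}.
Implicit Types (t s : R) (m : nat).

Definition past_grid t m (i : nat) : R := t - i%:R / m.+1%:R.
Definition future_grid t m (i : nat) : R := t + i.+1%:R / m.+1%:R.
(** Points at or before [t] are sent to points at or before [t], and points
    after [t] strictly after [t]; the minimum keeps the range finite.  Resampling
    along the grid therefore separates the past from the future. *)
Definition grid t m s : R :=
  if s <= t then past_grid t m (minn (m.+1 ^ 2) (Num.truncn ((t - s) * m.+1%:R)))
  else future_grid t m (minn (m.+1 ^ 2) (Num.truncn ((s - t) * m.+1%:R))).
Definition grid_times t m : seq R :=
  mkseq (past_grid t m) (m.+1 ^ 2).+1 ++ mkseq (future_grid t m) (m.+1 ^ 2).+1.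

Lemma grid_mem t m s : grid t m s \in grid_times t m.
Proof.
rewrite mem_cat /grid; case: ifP => _; apply/orP; [left|right];
  by apply/mapP; eexists; last reflexivity; rewrite mem_iota /= ltnS geq_minl.
Qed.

Lemma truncn_cell (y : R) m : 0 <= y ->
  0 <= y - (Num.truncn (y * m.+1%:R))%:R / m.+1%:R <= m.+1%:R^-1.
Proof.
move=> y0; have m0 : 0 < m.+1%:R :> R by [].
have /andP[] := truncn_itv (mulr_ge0 y0 (ltW m0)).
rewrite -(natr1 (Num.truncn _)); move: (Num.truncn _)%:R => k h1 h2.
rewrite -{1 2}(mulfK (lt0r_neq0 m0) y) -mulrBl.
rewrite mulr_ge0 ?subr_ge0 // ?invr_ge0 //=.
by rewrite ler_piMl // ?invr_ge0 //; lra.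
Qed.

Lemma grid_close t m s : `|s - t| <= m.+1%:R -> `|grid t m s - s| <= m.+1%:R^-1.
Proof.
move=> st; have m0 : 0 < m.+1%:R :> R by [].
have sq (y : R) : 0 <= y -> y <= m.+1%:R -> (Num.truncn (y * m.+1%:R) <= m.+1 ^ 2)%N.
  move=> y0 ym; rewrite -(ler_nat R) natrX.
  apply: (@le_trans _ _ (y * m.+1%:R)); first by rewrite truncn_le mulr_ge0.
  by rewrite expr2 ler_wpM2r.
rewrite /grid; case: (leP s t) => [st'|ts].
  have y0 : 0 <= t - s by rewrite subr_ge0.
  have ym : t - s <= m.+1%:R.
    by apply: le_trans st; rewrite distrC ler_norm.
  rewrite (minn_idPr (sq _ y0 ym)).
  have := truncn_cell m y0; rewrite /past_grid.
  move: (_^-1) (_ / _) => v k /andP[h1 h2]; rewrite ger0_norm; lra.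
have y0 : 0 <= s - t by rewrite subr_ge0 ltW.
have ym : s - t <= m.+1%:R by apply: le_trans st; rewrite ler_norm.
rewrite (minn_idPr (sq _ y0 ym)).
have := truncn_cell m y0; rewrite /future_grid; move: (Num.truncn _) => i.
rewrite -(natr1 i) mulrDl mul1r.
by move: (_^-1) (_ / _) => v k /andP[h1 h2]; rewrite ger0_norm; lra.
Qed.

Lemma grid_cvg t (d : R) : 0 < d -> exists n, forall m s, (n <= m)%N ->
  `|s| <= d^-1 -> `|grid t m s - s| < d.
Proof.
move=> d0; exists (maxn (Num.truncn (d^-1 + `|t|)) (Num.truncn d^-1)) => m s.
rewrite geq_max => /andP[n1 n2] sd; apply: le_lt_trans (grid_close _) _.
  apply: le_trans (ler_normB _ _) _.
  apply: (@le_trans _ _ (d^-1 + `|t|)); first by rewrite lerD2r.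
  by apply: ltW; apply: lt_le_trans (truncnS_gt _) _; rewrite ler_nat ltnS.
rewrite invf_plt ?posrE //.
by apply: lt_le_trans (truncnS_gt _) _; rewrite ler_nat ltnS.
Qed.

Lemma past_grid_le t m i : past_grid t m i <= t.
Proof. by rewrite /past_grid lerBlDr lerDl divr_ge0. Qed.

Lemma future_grid_gt t m i : t < future_grid t m i.
Proof. by rewrite /future_grid ltrDl divr_gt0. Qed.

Lemma future_grid_lt t m i j : (i < j)%N -> future_grid t m i < future_grid t m j.
Proof. by move=> ij; rewrite /future_grid ltrD2l ltr_pM2r ?invr_gt0 // ltr_nat ltnS. Qed.

End Grid.

(** * Sampled paths and frozen pasts *)

Section Ptws.
Context {R : realType} {E : metricType R} {n : nat}.
Implicit Types (x y : {ptws 'I_n.+1 -> E}) (g : {ptws 'I_n.+1 -> E} -> R).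

Lemma ptws_near x (d : R) : 0 < d -> \forall y \near x, forall i, mdist (x i) (y i) < d.
Proof.
move=> d0.
apply: (@filter_forall _ _ (fun i y => mdist (x i) (y i) < d) _ (nbhs_filter x)) => i.
have /metricType_numDomainType.cvgr_dist_lt := @proj_continuous _ (fun=> E) i x.
by move=> /(_ (nbhs_filter x) d d0); exact.
Qed.

(** In a finite power the uniform neighbourhoods form a filter that converges
    pointwise, hence in the product topology. *)
Lemma ptws_continuous g x (e : R) : continuous g -> 0 < e ->
  exists2 d, 0 < d & forall y, (forall i, mdist (x i) (y i) < d) -> `|g x - g y| < e.
Proof.
move=> cg e0.
pose F := filter_from [set d : R | 0 < d]
  (fun d => [set y : {ptws 'I_n.+1 -> E} | forall i, mdist (x i) (y i) < d]).
have FF : Filter F.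
  apply: filter_from_filter; first by exists 1 => /=.
  move=> a b /= a0 b0; exists (Num.min a b); first by rewrite /= lt_min a0.
  by move=> y /= h; split=> i; have := h i; rewrite lt_min => /andP[].
have Fx : {ptws, F --> x}.
  apply/cvg_sup => i A; rewrite nbhsE => -[U [[V oV <-] Vx] UA].
  have /nbhs_ballP[d d0 hd] : nbhs (x i) V by exact: open_nbhs_nbhs.
  exists d => // y /= hy; apply: UA => /=; apply: hd.
  by rewrite ballEmdist /=; exact: hy.
have gx : g @ F --> g x by apply: cvg_trans (cg x); exact: cvg_app.
have /cvgrPdist_lt/(_ _ e0)[d d0 hd] := gx.
by exists d.
Qed.

End Ptws.

Section Paths.
Context {R : realType} {E : metricType R} {Omega : topologicalType}.
Context (X : R -> Omega -> E).
Context (hsep : exists2 D : set E, countable D & dense D).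
Context (hcad : forall w, cadlag (X ^~ w)).

Lemma past_sigma_sub t : past_sigma X t `<=` full_sigma X.
Proof.
apply: smallest_sub; first exact: smallest_sigma_algebra.
by apply: subset_trans (@sub_sigma_algebra _ _ _); exact: bigcup_subset.
Qed.

Lemma fd_lip_usab (ts : seq R) (f : (R -> E) -> R) (F : Omega -> R -> E) :
  bounded_lip f ->
  (forall w w' d, 0 < d -> near_at X ts d w w' ->
     forall s, mdist (F w s) (F w' s) < d) ->
  usab (full_sigma X) (f \o F).
Proof.
move=> [[M hM] [L L0 hL]] hF; apply: (fd_usab hsep (ts := ts)) => //.
  by apply: (@bounded_funI _ _ _ M) => w; exact: hM.
move=> w e e0; have d0 : 0 < e / (L * 2) by rewrite divr_gt0 // mulr_gt0.
exists (e / (L * 2)) => // w' /(hF _ _ _ d0) h.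
have := graph_dist_unif d0 h; rewrite -(ler_pM2l L0) => h2.
have := hL (F w) (F w'); rewrite ler_norml => /andP[h3 _] /=.
have : L * (e / (L * 2)) < e.
  have -> : L * (e / (L * 2)) = e / 2 by field; rewrite gt_eqF.
  by rewrite gtr_pMr // invf_lt1 // ltr1n.
by lra.
Qed.

Lemma grid_usab t m (f : (R -> E) -> R) : bounded_lip f ->
  usab (full_sigma X) (fun w => f (X ^~ w \o grid t m)).
Proof.
move=> hf; apply: (@fd_lip_usab (grid_times t m) f (fun w => X ^~ w \o grid t m)) => //.
by move=> w w' d d0 h s; apply: h; exact: grid_mem.
Qed.

(** The resampled functions depend on finitely many coordinates and converge
    pointwise to the function. *)
Lemma bounded_lip_usab (f : (R -> E) -> R) : bounded_lip f ->
  usab (full_sigma X) (fun w => f (X ^~ w)).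
Proof.
move=> hf; have [[M hM] [L L0 hL]] := hf.
apply: (usab_lim (fun m => grid_usab 0 m hf)).
  by apply: (@bounded_funI _ _ _ M).
move=> w; apply/cvgrPdist_le => e e0.
have e'0 : 0 < e / L by rewrite divr_gt0.
have [d d0 hd] := graph_dist_resample (hcad w) e'0.
have [n hn] := grid_cvg 0 d0.
exists n => // m /= nm; apply: le_trans (hL _ _) _.
rewrite graph_dist_sym mulrC -ler_pdivlMr //; apply: hd; first by rewrite graph_distxx.
by move=> s; exact: hn.
Qed.

(** The resampled path of [w'] whose part up to [t] is taken from [w]; on the
    event [past_agree t m w] of the past it is the resampled path of [w']. *)
Definition freeze t m (w w' : Omega) : R -> E :=
  fun s => if s <= t then X (grid t m s) w else X (grid t m s) w'.

Lemma freeze_usab t m w (f : (R -> E) -> R) : bounded_lip f ->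
  usab (full_sigma X) (f \o freeze t m w).
Proof.
move=> hf; apply: (@fd_lip_usab (grid_times t m) f) => // v v' d d0 h s.
by rewrite /freeze; case: ifP => _; rewrite ?mdistxx //; apply: h; exact: grid_mem.
Qed.

Lemma freeze_cylinder t m w (f : (R -> E) -> R) : bounded_lip f ->
  cylinder_after X t (f \o freeze t m w).
Proof.
move=> [[M hM] [L L0 hL]].
pose P (x : 'I_(m.+1 ^ 2).+1 -> E) s := if s <= t then X (grid t m s) w
  else x (inord (minn (m.+1 ^ 2) (Num.truncn ((s - t) * m.+1%:R)))).
exists (m.+1 ^ 2)%N, (future_grid t m), (f \o P); split.
- by move=> i; exact: future_grid_gt.
- by move=> i j; exact: future_grid_lt.
- split; last by apply: (@bounded_funI _ _ _ M) => x; exact: hM.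
  move=> x.
  have [_] := @cvgrPdist_le _ _ _ _ (nbhs_filter x) (f \o P) ((f \o P) x).
  apply=> e e0.
  have d0 : 0 < e / L by rewrite divr_gt0.
  apply: (@filterS _ _ (nbhs_filter x) _ _ _ (ptws_near x d0)) => y hy /=.
  apply: le_trans (hL _ _) _; rewrite mulrC -ler_pdivlMr //.
  apply: graph_dist_unif => // s.
  by rewrite /P; case: ifP => _; rewrite ?mdistxx.
- apply/funext => w' /=; congr f; apply/funext => s; rewrite /freeze /P.
  case: ifPn => // st; congr (X _ w').
  by rewrite /grid (negbTE st) inordK // ltnS geq_minl.
Qed.

Definition past_agree t m (w : Omega) : set Omega :=
  \bigcap_(i : nat) [set w' | X (past_grid t m i) w' = X (past_grid t m i) w].

Lemma past_agree_sigma t m w : past_sigma X t (past_agree t m w).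
Proof.
apply: generated_bigcap => i; apply: sub_sigma_algebra.
exists (past_grid t m i); first exact: past_grid_le.
exists [set X (past_grid t m i) w]; last by rewrite setTI.
rewrite -[[set _]]setCK; apply: generatedC; apply: sub_sigma_algebra.
apply: closed_openC; apply: accessible_closed_set1.
by apply: hausdorff_accessible; exact: metric_hausdorff.
Qed.

Lemma past_agree_freeze t m w w' : past_agree t m w w' ->
  freeze t m w w' = X ^~ w' \o grid t m.
Proof.
move=> h; apply/funext => s; rewrite /freeze /=.
case: ifPn => // st; rewrite /grid st; exact/esym/h.
Qed.

Lemma cylinder_usab t phi : cylinder_after X t phi -> usab (full_sigma X) phi.
Proof.
move=> [n [ts [g [_ _ [cg /bounded_fun_ex[M hM]] ->]]]].
apply: (fd_usab hsep (ts := map ts (enum 'I_n.+1))) => //.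
  by apply: (@bounded_funI _ _ _ M) => w; exact: hM.
move=> w e e0; have [d d0 hd] := ptws_continuous (fun i => X (ts i) w) cg e0.
exists d => // w' h.
have : `|g (fun i => X (ts i) w) - g (fun i => X (ts i) w')| < e.
  by apply: hd => i; apply: h; apply: map_f; rewrite mem_enum.
by rewrite ltr_norml => /andP[h1 h2]; lra.
Qed.

End Paths.

(** * Graph-closed sets and their trees *)

Section GClosed.
Context {R : realType} {E : metricType R} {Omega : Type}.
Context (X : R -> Omega -> E).

(** Closed for the pseudometric [graph_dist], expressed on the abstract index
    set of paths. *)
Definition graph_closed (A : set Omega) : Prop := forall w, ~ A w ->
  exists2 r, 0 < r & forall w', A w' -> r <= graph_dist (X ^~ w) (X ^~ w').

Lemma graph_closed0 : graph_closed set0.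
Proof. by move=> w _; exists 1. Qed.

Lemma graph_closedT : graph_closed setT.
Proof. by move=> w /(_ I). Qed.

Lemma graph_closedU A B : graph_closed A -> graph_closed B -> graph_closed (A `|` B).
Proof.
move=> hA hB w /not_orP[/hA[r r0 hr] /hB[s s0 hs]].
by exists (Num.min r s); [rewrite lt_min r0|move=> w' [/hr|/hs] h; rewrite ge_min h ?orbT].
Qed.

Lemma graph_closedI A B : graph_closed A -> graph_closed B -> graph_closed (A `&` B).
Proof.
move=> hA hB w /not_andP[/hA|/hB] [r r0 hr]; exists r => // w' [Aw Bw]; exact: hr.
Qed.

Lemma graph_closed_bounded_union (n : nat) (A : nat -> set Omega) :
  (forall i, graph_closed (A i)) -> graph_closed [set w | exists2 i, (i <= n)%N & A i w].
Proof.
move=> hA; elim: n => [|n ih].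
  rewrite (_ : [set _ | _] = A 0%N) //; apply/seteqP; split=> w /=.
    by move=> [i]; rewrite leqn0 => /eqP ->.
  by exists 0%N.
rewrite (_ : [set _ | _] = [set w | exists2 i, (i <= n)%N & A i w] `|` A n.+1).
  exact: graph_closedU.
apply/seteqP; split=> w /=.
  by move=> [i]; rewrite leq_eqVlt => /predU1P[->|]; [right|left; exists i].
by move=> [[i /leqW]|]; [exists i|exists n.+1].
Qed.

Context (hcad : forall w, cadlag (X ^~ w)).

(** If [X u w] is outside [F], every path near [w] takes a value near [X u w]
    at some time near [u], hence outside [F] and inside the open interval. *)
Lemma graph_closed_stay (s d : R) (F : set E) :
  (forall x, ~ F x -> exists2 r, 0 < r & forall y, F y -> r <= mdist x y) ->
  graph_closed [set w | forall u, s < u -> u < s + d -> F (X u w)].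
Proof.
move=> hF w /existsNP[u /not_implyP[su /not_implyP[ud nF]]].
have [r r0 hr] := hF _ nF.
pose e := Num.min r (Num.min (Num.min (u - s) (s + d - u)) (`|u| + 1)^-1).
have u0 : 0 < `|u| + 1 by rewrite ltr_wpDl.
have e0 : 0 < e by rewrite !lt_min r0 invr_gt0 u0 !subr_gt0 su ud.
have er : e <= r by rewrite ge_min lexx.
have eu : e <= u - s by rewrite !ge_min lexx !orbT.
have ed : e <= s + d - u by rewrite !ge_min lexx !orbT.
have eV : e <= (`|u| + 1)^-1 by rewrite !ge_min lexx !orbT.
have e1 : e <= 1.
  by apply: (le_trans eV); rewrite invf_le1 // lerDr.
exists e => // w' hw'; rewrite leNgt; apply/negP => /graph_dist_lt/(_ e1)[h _].
have [|v] := h u.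
  have : `|u| + 1 <= e^-1 by rewrite -[leLHS]invrK lef_pV2 ?posrE ?invr_gt0.
  by apply: le_trans; rewrite lerDl.
rewrite ltr_norml => /andP[vu1 vu2]; apply/negP; rewrite -leNgt.
by apply: (le_trans er); apply: hr; apply: hw'; lra.
Qed.

(** By right continuity [X s w] lies in [U] iff on some interval after [s] the
    path stays at distance at least [1/(i+1)] from the complement of [U], and
    this condition is graph-closed. *)
Lemma coord_open_analytic (s : R) (U : set E) : open U ->
  analytic graph_closed [set w | U (X s w)].
Proof.
move=> oU.
pose F i := [set x | forall y, ~ U y -> i.+1%:R^-1 <= mdist x y :> R].
rewrite (_ : [set w | _] = \bigcup_i
  [set w | forall u, s < u -> u < s + i.+1%:R^-1 -> F i (X u w)]).
  apply: analytic_bigcup => i; apply: sub_analytic; apply: graph_closed_stay.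
  move=> x /existsNP[y /not_implyP[nUy /negP]]; rewrite -ltNge => xy.
  exists (i.+1%:R^-1 - mdist x y); first by rewrite subr_gt0.
  move=> z /(_ y nUy) zy; rewrite lerBlDr (le_trans zy) // (metric_sym x z).
  exact: metric_triangle.
apply/seteqP; split=> w /=.
  move=> Uw; have /nbhs_ballP[e /= e0 he] : nbhs (X s w) U by exact: open_nbhs_nbhs.
  have e20 : 0 < e / 2 by lra.
  have [d d0 hd] := cvg_right_mdist (hcad w s).1 e20.
  have [k] : exists k, 0 + k.+1%:R^-1 < Num.min d (e / 2) :> R.
    by apply: ltr_add_invr; rewrite lt_min d0.
  rewrite add0r lt_min => /andP[kd ke].
  exists k => // u su ud y nUy; rewrite leNgt; apply/negP => uy; apply: nUy.
  apply: he; rewrite ballEmdist /=.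
  have := hd u su; have := metric_triangle (X s w) (X u w) y.
  by move: (k.+1%:R^-1 : R) kd ke ud uy => a; move=> *; lra.
move=> [i _ h]; apply: contrapT => nU.
have i0 : 0 < i.+1%:R^-1 :> R by rewrite invr_gt0.
have [d d0 hd] := cvg_right_mdist (hcad w s).1 i0.
pose c := Num.min d i.+1%:R^-1.
have c0 : 0 < c by rewrite lt_min d0.
have cd : c <= d by rewrite ge_min lexx.
have ci : c <= i.+1%:R^-1 by rewrite ge_min lexx orbT.
have su : s < s + c / 2 by lra.
have si : s + c / 2 < s + i.+1%:R^-1.
  by move: (i.+1%:R^-1 : R) ci => a ci; lra.
by have := h _ su si _ nU; rewrite leNgt metric_sym hd //; lra.
Qed.

(** The complement of [U] is the intersection of its open neighbourhoods of
    radius [1/(i+1)]. *)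
Lemma coord_closed_analytic (s : R) (U : set E) : open U ->
  analytic graph_closed [set w | ~ U (X s w)].
Proof.
move=> oU.
pose V (i : nat) : set E := \bigcup_(y in ~` U) [set x | mdist x y < i.+1%:R^-1].
rewrite (_ : [set w | _] = \bigcap_i [set w | V i (X s w)]).
  apply: analytic_bigcap => i; apply: coord_open_analytic.
  apply: bigcup_open => y _; rewrite openE => x /= xy.
  apply/nbhs_ballP; exists (i.+1%:R^-1 - mdist x y) => /=; first by rewrite subr_gt0.
  move=> z; rewrite ballEmdist /= ltrBrDr (metric_sym x z).
  exact/le_lt_trans/metric_triangle.
apply/seteqP; split=> w /=.
  by move=> nU i _; exists (X s w) => //=; rewrite mdistxx.
move=> h Uw; have /nbhs_ballP[e /= e0 he] : nbhs (X s w) U by exact: open_nbhs_nbhs.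
have [k] : exists k, 0 + k.+1%:R^-1 < e :> R by exact: ltr_add_invr.
rewrite add0r => ke; have [y nUy /= ys] := h k I.
by apply: nUy; apply: he; rewrite ballEmdist /=; exact: lt_trans ke.
Qed.

Lemma bianalytic_sigma_algebra (T : Type) (G : set_system T) :
  G set0 -> G setT ->
  sigma_algebra setT [set A | analytic G A /\ analytic G (~` A)].
Proof.
move=> G0 GT; split => /=.
- by split; [exact: sub_analytic|rewrite setC0; exact: sub_analytic].
- by move=> A [A1 A2]; rewrite setTD setCK.
- move=> A hA; split; first by apply: analytic_bigcup => i; exact: (hA i).1.
  by rewrite setC_bigcup; apply: analytic_bigcap => i; exact: (hA i).2.
Qed.

End GClosed.

Section FullSigmaAnalytic.
Context {R : realType} {E : metricType R} {Omega : topologicalType}.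
Context (X : R -> Omega -> E).
Context (hcad : forall w, cadlag (X ^~ w)).

(** Bi-analytic sets form a sigma-algebra, which contains the preimages of open
    sets under the coordinates. *)
Lemma full_sigma_analytic : full_sigma X `<=` analytic (graph_closed X).
Proof.
have hB := bianalytic_sigma_algebra (graph_closed0 X) (graph_closedT X).
suff h : full_sigma X `<=` [set A | analytic (graph_closed X) A /\
    analytic (graph_closed X) (~` A)].
  by move=> A /h[].
apply: smallest_sub => // A [s _ [B hB' <-]]; rewrite setTI.
pose S := [set B : set E | analytic (graph_closed X) (X s @^-1` B) /\
  analytic (graph_closed X) (~` (X s @^-1` B))].
suff : @borel E `<=` S by apply.
apply: smallest_sub; last first.
  by move=> U oU; split; [exact: coord_open_analytic|exact: coord_closed_analytic].
have [h0 hC hU] := hB; split.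
- by move: h0; rewrite /S /= preimage_set0.
- by move=> D [D1 D2]; rewrite /S /= setTD preimage_setC setCK.
- by move=> D hD; rewrite /S /= preimage_bigcup; exact: hU.
Qed.

End FullSigmaAnalytic.

Section Koenig.
Context {R : realType} {E : metricType R} {Omega : Type}.
Context (X : R -> Omega -> E) (S : seq nat -> set Omega).
Hypothesis hS : forall s, graph_closed X (S s).

(** The points [w] for which some sequence [q], bounded entrywise by [ns], has
    [w] in all [S (s ++ q')] with [q'] a nonempty prefix of [q].  Recursion on
    the bounds presents the set as finite unions and intersections. *)
Fixpoint bounded_branch (s ns : seq nat) : set Omega :=
  if ns is n :: ns' then
    [set w | exists2 i, (i <= n)%N & (S (rcons s i) `&` bounded_branch (rcons s i) ns') w]
  else setT.

Lemma bounded_branch_closed s ns : graph_closed X (bounded_branch s ns).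
Proof.
elim: ns s => [|n ns ih] s /=; first exact: graph_closedT.
by apply: graph_closed_bounded_union => i; exact: graph_closedI.
Qed.

Lemma bounded_branch_cat s ns ms :
  bounded_branch s (ns ++ ms) `<=` bounded_branch s ns.
Proof.
elim: ns s => [|n ns ih] s //= w [i i_n [Sw Bw]].
by exists i => //; split => //; exact: ih Bw.
Qed.

Definition bound_from (n : nat -> nat) i k := map n (iota i k).

Lemma bounded_branch_mono s n i k k' : (k <= k')%N ->
  bounded_branch s (bound_from n i k') `<=` bounded_branch s (bound_from n i k).
Proof.
by move=> /subnKC <-; rewrite /bound_from iotaD map_cat; exact: bounded_branch_cat.
Qed.

(** If each [i <= n] failed at some stage, all would fail at the largest of
    these stages. *)
Lemma antitone_pigeonhole (n : nat) (P : nat -> nat -> Prop) :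
  (forall i k k', (k <= k')%N -> P i k' -> P i k) ->
  (forall k, exists2 i, (i <= n)%N & P i k) ->
  exists2 i, (i <= n)%N & forall k, P i k.
Proof.
move=> mono h; apply: contrapT => nex.
have /choice[c hc] : forall i, exists k, (i <= n)%N -> ~ P i k.
  move=> i; have [i_n|] := boolP (i <= n)%N; last by exists 0%N.
  have /existsNP[k nP] : ~ forall k, P i k by move=> Pi; apply: nex; exists i.
  by exists k.
have [i i_n Pi] := h (\max_(j < n.+1) c j).
apply: (hc i i_n); apply: mono Pi.
exact: (@leq_bigmax _ (fun j : 'I_n.+1 => c j) (Ordinal (i_n : (i < n.+1)%N))).
Qed.

(** The property carried along the branch is that bounded branches of every
    length start at the current node. *)
Lemma koenig (n : nat -> nat) w :
  (forall k, bounded_branch [::] (mkseq n k) w) ->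
  exists p : nat -> nat, forall k, S (mkseq p k.+1) w.
Proof.
move=> h.
pose P s := (forall k, bounded_branch s (bound_from n (size s) k) w) /\
  (s != [::] -> S s w).
have [|s [hs _]|p hp] := @prefix_choice P; first by split => // k; exact: h.
  have [||i _ hi] := @antitone_pigeonhole (n (size s)) (fun i k => S (rcons s i) w /\
    bounded_branch (rcons s i) (bound_from n (size s).+1 k) w).
  - by move=> i k k' kk [Sw Bw]; split => //; exact: bounded_branch_mono kk _ Bw.
  - by move=> k; have [i i_n [Sw Bw]] := hs k.+1; exists i.
  exists i; split => [k|_]; last exact: (hi 0%N).1.
  by rewrite size_rcons; exact: (hi k).2.
exists p => k; have [_] := hp k.+1; apply.
by rewrite mkseqS; case: (mkseq p k).
Qed.

Lemma branch_bounded (p n : nat -> nat) w i k :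
  (forall j, S (mkseq p j.+1) w) -> (forall j, (j < i + k)%N -> (p j <= n j)%N) ->
  bounded_branch (mkseq p i) (bound_from n i k) w.
Proof.
move=> hS'; elim: k i => [|k ih] i pn //=.
exists (p i); first by apply: pn; rewrite addnS ltnS leq_addr.
by rewrite -mkseqS; split => //; apply: ih => j; rewrite addSnnS; exact: pn.
Qed.

End Koenig.

(** * Comparison on Lipschitz functions of the path *)

Section Functional.
Context {R : realType} {E : metricType R} {Omega : topologicalType}.
Context (X : R -> Omega -> E) (t : R) (w : Omega).
Implicit Types (EE : (Omega -> R) -> R -> Omega -> R) (phi psi : Omega -> R).
Local Notation Fs := (full_sigma X).

Let F0 : Fs set0. Proof. exact: generated0. Qed.
Let FT : Fs setT. Proof. exact: generatedT. Qed.

Lemma ce_cst EE c : convex_expectation X EE -> EE (fun=> c) t w = c.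
Proof.
move=> h; rewrite (ce_id h) //.
by apply: usab_cst; [exact: generated0|exact: generatedT].
Qed.

(** Write [phi + psi = (1-s) phi + s (phi + psi/s)] and
    [phi + psi/s = (2 phi)/2 + (2 psi/s)/2].  Convexity bounds the increment by
    [s] times a constant depending on [M], and [a = 2/s] works. *)
Lemma ce_perturb (M d : R) : 0 < d -> exists2 a, 0 < a &
  forall EE phi psi, convex_expectation X EE -> usab Fs phi -> usab Fs psi ->
    (forall x, `|phi x| <= M) -> EE (fun x => a * psi x) t w <= 1 ->
    EE (fun x => phi x + psi x) t w <= EE phi t w + d.
Proof.
move=> d0; have [N N0 MN] : exists2 N, 0 <= N & M <= N by exists `|M|; rewrite ?ler_norm.
pose s := d / (N * 2 + 1 + d).
have D0 : 0 < N * 2 + 1 + d by lra.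
have s0 : 0 < s by rewrite divr_gt0.
have s1 : s < 1 by rewrite ltr_pdivrMr //; lra.
have sd : s * (N * 2 + 1) <= d.
  by rewrite mulrAC ler_pdivrMr // ler_pM2l //; lra.
exists (2 / s); first by rewrite divr_gt0 //.
move=> EE phi psi h uphi upsi hM ha.
have u1 : usab Fs (fun x => s^-1 * psi x) by apply: usabZ; rewrite // ltW ?invr_gt0.
have u2 : usab Fs (fun x => phi x + s^-1 * psi x) by apply: usabD.
have u3 : usab Fs (fun x => 2 * phi x) by apply: usabZ.
have u4 : usab Fs (fun x => 2 / s * psi x) by apply: usabZ; rewrite // ltW ?divr_gt0.
have i1 : EE (fun x => phi x + psi x) t w <=
    (1 - s) * EE phi t w + s * EE (fun x => phi x + s^-1 * psi x) t w.
  have l : 0 < 1 - s < 1 by lra.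
  have := ce_convex h t uphi u2 l w; rewrite subKr.
  congr (EE _ t w <= _); apply/funext => x; field.
  by rewrite gt_eqF.
have i2 : EE (fun x => phi x + s^-1 * psi x) t w <=
    2^-1 * EE (fun x => 2 * phi x) t w + 2^-1 * EE (fun x => 2 / s * psi x) t w.
  have l : 0 < (2^-1 : R) < 1 by lra.
  have := ce_convex h t u3 u4 l w.
  rewrite (_ : 1 - 2^-1 = 2^-1 :> R); last by field.
  congr (EE _ t w <= _); apply/funext => x; field.
  by rewrite gt_eqF.
have i3 : EE (fun x => 2 * phi x) t w <= N * 2.
  rewrite -[leRHS](ce_cst _ h); apply: (ce_monotone h) => // [|x].
    exact: usab_cst.
  by have := hM x; rewrite ler_norml; lra.
have i4 : - N <= EE phi t w.
  rewrite -[leLHS](ce_cst _ h); apply: (ce_monotone h) => // [|x].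
    exact: usab_cst.
  by have := hM x; rewrite ler_norml; lra.
have i5 : s * (EE (fun x => phi x + s^-1 * psi x) t w - EE phi t w) <= s * (N * 2 + 1).
  by rewrite ler_pM2l //; lra.
by move: i1 i5; rewrite mulrBr mulrBl mul1r; lra.
Qed.

(** [phi] is at most [psi] plus a multiple of the indicator of the complement
    of [A]; all multiples of this indicator belong to the past, so the
    functional returns their value at [w], which is 0. *)
Lemma ce_local EE phi psi (A : set Omega) : convex_expectation X EE ->
  usab Fs phi -> usab Fs psi -> past_sigma X t A -> A w ->
  {in A, phi =1 psi} -> EE phi t w <= EE psi t w.
Proof.
move=> h uphi upsi sA Aw eqA; apply/ler_addgt0Pr => d d0.
have [M hM] := usab_bound uphi; have [N hN] := usab_bound upsi.
have [a a0 ha] := ce_perturb N d0.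
have P0 : past_sigma X t set0 by exact: generated0.
have PT : past_sigma X t setT by exact: generatedT.
have MN0 : 0 <= M + N.
  by rewrite addr_ge0 ?(le_trans (normr_ge0 _) (hM w)) ?(le_trans (normr_ge0 _) (hN w)).
have uA (c : R) : 0 <= c -> usab (past_sigma X t) (fun x => c * \1_(~` A) x).
  by move=> c0; apply: usab_indic => //; apply: sub_analytic; exact: generatedC.
have uA' : usab Fs (fun x => (M + N) * \1_(~` A) x).
  exact: usab_mono (@past_sigma_sub _ _ _ X t) (uA _ MN0).
have vanish : EE (fun x => a * ((M + N) * \1_(~` A) x)) t w <= 1.
  under eq_fun do rewrite mulrA.
  rewrite (ce_id h); last by apply: uA; rewrite mulr_ge0 // ltW.
  by rewrite indicE in_setC mem_set //= mulr0 ler01.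
apply: le_trans (ha EE psi _ h upsi uA' hN vanish).
apply: (ce_monotone h) => // [|x]; first exact: usabD.
rewrite indicE in_setC; have [xA|xA] := boolP (x \in A).
  by rewrite (eqA x xA) mulr0 addr0.
by rewrite mulr1; have := hM x; have := hN x; rewrite !ler_norml; lra.
Qed.

Context (hsep : exists2 D : set E, countable D & dense D).
Context (hcad : forall w, cadlag (X ^~ w)).
Context (hCb : forall f : (R -> E) -> R, bounded_lip f -> Cb (fun w => f (X ^~ w))).

(** This is continuity from above with limit 0, stated in the form that
    [ce_perturb] consumes. *)
Lemma ce_vanishing EE (H : nat -> (R -> E) -> R) (a : R) :
  convex_expectation X EE -> (forall n, bounded_lip (H n)) ->
  decreases_to (fun n w' => H n (X ^~ w')) (fun=> 0) -> 0 < a ->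
  \forall n \near \oo, EE (fun w' => a * H n (X ^~ w')) t w <= 1.
Proof.
move=> h hH H0 a0.
have [_] : nonincreasing_seq (fun n => EE (fun w' => a * H n (X ^~ w')) t w) /\
    EE (fun w' => a * H n (X ^~ w')) t w @[n --> \oo] --> EE (fun=> 0) t w.
  apply: (ce_cont_above h) => [n||].
  - by apply: (hCb (f := fun x => a * H n x)); exact: bounded_lipZ.
  - exact: usab_cst.
  move=> w'; have [Hd Hc] := H0 w'; split.
    by move=> m n mn /=; rewrite ler_pM2l //; exact: Hd.
  by rewrite -(mulr0 a); apply: cvgMr.
rewrite ce_cst // => /(cvgr_le 0)/(_ 1); apply; exact: ltr01.
Qed.

(** With [f_n] the function [f] of the resampled path and [H n] a Lipschitz
    function above [|f_n - f|], the chain is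
    [EE f <= EE (f_n + H n) <= EE f_n + d/2], then [EE f_n <= EEhat f_n] by
    freezing the past, then [EEhat f_n <= EEhat (f + H n) <= EEhat f + d/2]. *)
Lemma compare_bounded_lip EE EEhat (f : (R -> E) -> R) :
  convex_expectation X EE -> convex_expectation X EEhat ->
  (forall phi, cylinder_after X t phi -> EE phi t w <= EEhat phi t w) ->
  bounded_lip f ->
  EE (fun w' => f (X ^~ w')) t w <= EEhat (fun w' => f (X ^~ w')) t w.
Proof.
move=> h hh hcomp hf; have [[M hM] [L L0 hL]] := hf.
(* Quantifying over all [m >= n] makes the values decrease with [n]. *)
pose Q n (y : R -> E) v := v = 0 \/
  exists2 m, (n <= m)%N & v = `|f (y \o grid t m) - f y|.
have Q0 n y : Q n y 0 by left.
have M0 : 0 <= M by apply: le_trans (hM (X ^~ w)).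
have QM n y v : Q n y v -> 0 <= v <= M + M.
  case=> [->|[m _ ->]]; first by rewrite lexx addr_ge0.
  by rewrite normr_ge0 (le_trans (ler_normB _ _)) // lerD.
have Qmono n y v : Q n.+1 y v -> Q n y v.
  by case=> [->|[m /ltnW nm ->]]; [left|right; exists m].
pose H := sup_conv Q.
have hH n : bounded_lip (H n) by exact: (sup_conv_bounded_lip Q0 QM).
have H0 : decreases_to (fun n w' => H n (X ^~ w')) (fun=> 0).
  move=> w'; split; first exact: (sup_conv_nonincreasing Q0 QM Qmono).
  apply: (sup_conv_cvg Q0 QM Qmono) => // [n|e e0]; first exact: (sup_conv_ge0 Q0 QM).
  have e'0 : 0 < e / L by rewrite divr_gt0.
  have [d d0 hd] := graph_dist_resample (hcad w') e'0.
  have [n hn] := grid_cvg t d0.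
  (* One [n] and one radius [d] serve all [m >= n] and all [y] near the path. *)
  exists n, d => // y v xy [->|[m nm ->]]; first by rewrite add0r ltW.
  rewrite add0r; apply: le_trans (hL _ _) _; rewrite mulrC -ler_pdivlMr //.
  by apply: hd => // s; exact: hn.
have uH n : usab Fs (fun w' => H n (X ^~ w')) by exact: bounded_lip_usab.
have ug n : usab Fs (fun w' => f (X ^~ w' \o grid t n)) by exact: grid_usab.
have uf : usab Fs (fun w' => f (X ^~ w')) by exact: bounded_lip_usab.
have gap n w' : `|f (X ^~ w' \o grid t n) - f (X ^~ w')| <= H n (X ^~ w').
  by apply: (sup_conv_ge QM); right; exists n.
apply/ler_addgt0Pr => d d0.
have [a a0 ha] := ce_perturb M (divr_gt0 d0 (ltr0Sn R 1)).
have [n _ hn] := filterI (ce_vanishing h hH H0 a0) (ce_vanishing hh hH H0 a0).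
have [/= hn1 hn2] := hn n (leqnn n).
have s1 := ha EE _ _ h (ug n) (uH n) (fun w' => hM _) hn1.
have s2 := ha EEhat _ _ hh uf (uH n) (fun w' => hM _) hn2.
have s3 : EE (fun w' => f (X ^~ w')) t w <=
    EE (fun x => f (X ^~ x \o grid t n) + H n (X ^~ x)) t w.
  apply: (ce_monotone h) => // [|x]; first exact: usabD.
  by have := gap n x; rewrite ler_norml; lra.
have s4 : EEhat (fun x => f (X ^~ x \o grid t n)) t w <=
    EEhat (fun x => f (X ^~ x) + H n (X ^~ x)) t w.
  apply: (ce_monotone hh) => // [|x]; first exact: usabD.
  by have := gap n x; rewrite ler_norml; lra.
have agree : past_agree X t n w w by [].
have sagree : past_sigma X t (past_agree X t n w) by exact: past_agree_sigma.
have ufr : usab Fs (f \o freeze X t n w) by exact: freeze_usab.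
have s5 : EE (fun x => f (X ^~ x \o grid t n)) t w <= EE (f \o freeze X t n w) t w.
  apply: (ce_local h (ug n) ufr sagree agree) => x.
  by rewrite inE /= => /past_agree_freeze ->.
have s6 : EEhat (f \o freeze X t n w) t w <=
    EEhat (fun x => f (X ^~ x \o grid t n)) t w.
  apply: (ce_local hh ufr (ug n) sagree agree) => x.
  by rewrite inE /= => /past_agree_freeze ->.
have s7 := hcomp _ (freeze_cylinder X t n w hf).
by move: s1 s2; lra.
Qed.

End Functional.

(** * Capacitability *)

Section Layers.
Context {R : realType} {T : Type}.
Implicit Types (P : nat -> set T) (M e : R).

Definition layers M e J P : T -> R := fun x => - M + \sum_(j < J) e * \1_(P j) x.

Lemma layers_mono M e J P Q x : 0 <= e -> (forall j, P j `<=` Q j) ->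
  layers M e J P x <= layers M e J Q x.
Proof.
move=> e0 PQ; rewrite lerD2l; apply: ler_sum => j _; rewrite ler_wpM2l //.
rewrite !indicE; have [xP|//] := boolP (x \in P j).
by rewrite mem_set //; apply: PQ; exact: set_mem.
Qed.

Lemma layers_increases M e J (P : nat -> nat -> set T) Q : 0 <= e ->
  (forall n j, P n j `<=` P n.+1 j) -> (forall j, Q j = \bigcup_n P n j) ->
  increases_to (fun n => layers M e J (P n)) (layers M e J Q).
Proof.
move=> e0 Pmono QE x; split.
  by apply/nondecreasing_seqP => n; apply: layers_mono.
apply: cvgD; first exact: cvg_cst.
apply: cvg_big => [|j _ /=]; [exact: add_continuous|apply: cvgMr].
have Pm m n i : (m <= n)%N -> P m i `<=` P n i.
  move=> /subnK <-; elim: (n - m)%N => // k ih; rewrite addSn.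
  exact: subset_trans ih (Pmono _ _).
have [xQ|xQ] := pselect (Q j x).
  have [n _ xP] : (\bigcup_n P n j) x by rewrite -QE.
  apply: cvg_near_cst; exists n => // m /= nm.
  by rewrite !indicE !mem_set //; apply: (Pm n m j nm).
rewrite (_ : (fun n => _) = fun=> \1_(Q j) x); first exact: cvg_cst.
apply/funext => n; rewrite !indicE !memNset //.
by move=> xP; apply: xQ; rewrite QE; exists n.
Qed.

Lemma layers_usab G M e J P : G set0 -> G setT -> 0 <= e ->
  (forall j, analytic G (P j)) -> usab G (layers M e J P).
Proof.
move=> G0 GT e0 hP; apply: (usabD G0); first exact: usab_cst.
by apply: (@usab_sum _ _ _ G0 GT J (fun j x => e * \1_(P j) x)) => j; exact: usab_indic.
Qed.

(** The partial sum of the first [k] layers is the largest multiple of [e]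
    below [f x + M], capped at [k e]. *)
Lemma layers_approx M e J (f : T -> R) x : 0 < e -> `|f x| <= M -> M + M <= J%:R * e ->
  let L := layers M e J (fun j => [set x | j.+1%:R * e - M <= f x]) in
  - M <= L x /\ L x <= f x <= L x + e.
Proof.
move=> e0 fM MJ /=; rewrite /layers.
pose y := f x + M; have y0 : 0 <= y by move: fM; rewrite ler_norml /y; lra.
have yM : y <= J%:R * e by move: fM; rewrite ler_norml /y; lra.
have E j : \1_[set x | j.+1%:R * e - M <= f x] x = (j.+1%:R * e <= y)%R%:R :> R.
  rewrite indicE; congr ((nat_of_bool _)%:R); apply/idP/idP; rewrite inE /= /y => h; lra.
under eq_bigr do rewrite E.
pose s k := \sum_(j < k) e * (j.+1%:R * e <= y)%R%:R.
have sS k : s k.+1 = s k + e * (k.+1%:R * e <= y)%R%:R by rewrite /s big_ord_recr.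
have s0 k : 0 <= s k by apply: sumr_ge0 => j _; rewrite mulr_ge0 // ltW.
have h k : [/\ s k <= y, s k <= k%:R * e & y < s k + e \/ s k = k%:R * e].
  elim: k => [|k [h1 h2 h3]]; first by rewrite /s big_ord0 mul0r; split => //; right.
  rewrite sS; have [ky|ky] := leP (k.+1%:R * e) y; rewrite ?mulr1 ?mulr0 ?addr0.
    have ks : s k = k%:R * e.
      by case: h3 => // h3; move: ky; rewrite -natr1 mulrDl mul1r; lra.
    by move: ky; rewrite ks -natr1 mulrDl mul1r; split => //; right.
  split => //; first by rewrite -natr1 mulrDl mul1r; lra.
  by left; case: h3 => // ->; move: ky; rewrite -natr1 mulrDl mul1r.
have [h1 h2 h3] := h J; rewrite -/(s J) /y in h1 h3 yM *.
by have := s0 J; split; [lra|case: h3; lra].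
Qed.

End Layers.

Section Outer.
Context {R : realType} {E : metricType R} {Omega : topologicalType}.
Context (X : R -> Omega -> E).
Context (hsep : exists2 D : set E, countable D & dense D).
Context (hcad : forall w, cadlag (X ^~ w)).
Local Notation Fs := (full_sigma X).

(** Near a point outside the intersection some [B k] has no point, so the
    sup-convolution of the indicators of [B k] tends to 0 there. *)
Lemma closed_outer_lip (e : R) (B : nat -> set Omega) : 0 < e ->
  (forall k, graph_closed X (B k)) -> (forall k, B k.+1 `<=` B k) ->
  exists V : nat -> (R -> E) -> R,
    [/\ forall k, bounded_lip (V k), forall k w, e * \1_(B k) w <= V k (X ^~ w) &
      decreases_to (fun k w => V k (X ^~ w)) (fun w => e * \1_(\bigcap_k B k) w)].
Proof.
move=> e0 cB dB.
pose Q k (y : R -> E) v := v = 0 \/ v = e /\ exists2 w, B k w & y = X ^~ w.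
have Q0 k y : Q k y 0 by left.
have QM k y v : Q k y v -> 0 <= v <= e.
  by case=> [->|[-> _]]; rewrite lexx ltW.
have Qmono k y v : Q k.+1 y v -> Q k y v.
  by case=> [->|[-> [w /dB Bw yw]]]; [left|right; split => //; exists w].
exists (sup_conv Q).
have ge k w : e * \1_(B k) w <= sup_conv Q k (X ^~ w).
  rewrite indicE; have [wB|wB] := boolP (w \in B k).
    rewrite mulr1; apply: (sup_conv_ge QM); right; split => //.
    by exists w => //; exact: set_mem.
  by rewrite mulr0; exact: sup_conv_ge0 Q0 QM _ _.
split => // [k|w]; first exact: sup_conv_bounded_lip Q0 QM _.
split; first exact: sup_conv_nonincreasing Q0 QM Qmono _.
apply: (sup_conv_cvg Q0 QM Qmono) => [|k|d d0].
- by rewrite mulr_ge0 // ltW.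
- apply: le_trans (ge k w); rewrite ler_pM2l // !indicE.
  have [wB|//] := boolP (w \in \bigcap_k B k).
  by rewrite mem_set //; exact: (set_mem wB).
have [wB|/existsNP[k /not_implyP[_ wB]]] := pselect ((\bigcap_k B k) w).
  exists 0%N, 1 => // y v _ /QM/andP[_ ve].
  by rewrite indicE mem_set // mulr1 (le_trans ve) // lerDl ltW.
have [r r0 hr] := cB k w wB; exists k, r => // y v xy [->|[_ [w' Bw' yw]]].
  by apply: addr_ge0; [rewrite mulr_ge0 // ltW|exact: ltW].
by move: xy; rewrite yw ltNge hr.
Qed.

Lemma graph_closed_analytic A : graph_closed X A -> analytic Fs A.
Proof.
move=> cA.
have [V [bV _ dV]] :=
  @closed_outer_lip 1 (fun=> A) ltr01 (fun=> cA) (fun=> @subset_refl _ A).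
have cap : \bigcap_(k : nat) A = A.
  by apply/seteqP; split => w Aw; [exact: (Aw 0%N)|].
have : usab Fs (fun w => 1 * \1_A w : R).
  apply: (usab_lim (fun k => bounded_lip_usab hsep hcad (bV k))).
    apply: (@bounded_funI _ _ _ 1) => w.
    by rewrite mul1r indicE; case: (_ \in _); rewrite ?normr1 ?normr0.
  by move=> w; have [_] := dV w; rewrite cap.
move=> [_ /(_ 1)]; rewrite (_ : [set w | _] = A) //.
apply/seteqP; split => w /=; rewrite mul1r indicE; last by move=> /mem_set ->.
by have [/set_mem//|_] := boolP (w \in A); rewrite ler10.
Qed.

End Outer.

Section Capacity.
Context {R : realType} {E : metricType R} {Omega : topologicalType}.
Context (X : R -> Omega -> E).
Context (hsep : exists2 D : set E, countable D & dense D).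
Context (hcad : forall w, cadlag (X ^~ w)).
Context (hCb : forall f : (R -> E) -> R, bounded_lip f -> Cb (fun w => f (X ^~ w))).
Local Notation Fs := (full_sigma X).

(** Only the first entries of the branch [p] are bounded: as the last bound grows,
    these parts increase to the part without that bound, which is where
    continuity from below applies. *)
Definition dominated_part (S : seq nat -> set Omega) (s : seq nat) : set Omega :=
  [set w | exists p : nat -> nat, (forall i, (i < size s)%N -> (p i <= nth 0 s i)%N) /\
    forall l, S (mkseq p l.+1) w].

Lemma dominated_part_analytic S s : (forall u, graph_closed X (S u)) ->
  analytic Fs (dominated_part S s).
Proof.
move=> cS; apply: analytic_idem; apply: (analytic_mono (graph_closed_analytic hsep hcad)).
rewrite (_ : dominated_part S s = [set w | exists p : nat -> nat, forall l,
   (S (mkseq p l.+1) `&` [set _ | (l < size s)%N -> (p l <= nth 0 s l)%N]) w]).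
  apply: analytic_scheme => [l p|l p q pq].
    apply: graph_closedI => // w /= nw; exists 1 => // w' /= h; exfalso; exact: nw.
  by rewrite (@mkseq_ext p q) // pq.
apply/seteqP; split => w.
  by move=> [p [p1 p2]]; exists p => l; split => //=; exact: p1.
by move=> [p h]; exists p; split => [l|l]; have [] := h l.
Qed.

Lemma dominated_part_nil S : dominated_part S [::] =
  \bigcup_(n in setT) \bigcap_(k in setT) S (mkseq n k.+1).
Proof.
apply/seteqP; split => w; first by move=> [p [_ h]]; exists p.
by move=> [p _ h]; exists p; split => // l; exact: h.
Qed.

Lemma dominated_part_rcons S s n :
  dominated_part S (rcons s n) `<=` dominated_part S (rcons s n.+1).
Proof.
move=> w [p [h1 h2]]; exists p; split => // i; rewrite size_rcons => si.
have := h1 i; rewrite size_rcons => /(_ si); rewrite !nth_rcons.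
by case: ltnP => // _; case: eqP => // _; exact: leqW.
Qed.

Lemma dominated_part_bigcup S s :
  dominated_part S s = \bigcup_n dominated_part S (rcons s n).
Proof.
apply/seteqP; split => w.
  move=> [p [h1 h2]]; exists (p (size s)) => //; exists p; split => // i.
  rewrite size_rcons ltnS nth_rcons leq_eqVlt => /predU1P[->|si].
    by rewrite ltnn eqxx.
  by rewrite si; exact: h1.
move=> [n _ [p [h1 h2]]]; exists p; split => // i si.
by have := h1 i; rewrite size_rcons nth_rcons si; apply; exact: ltnW.
Qed.

(** Let [D s] be the family of dominated parts of the [A j], with one bound [s]
    for all [j].  Continuity from below allows a bound to be appended to [s]
    while the value of [EE] stays above [alpha]; this gives an infinite bound
    [n].  The part dominated by [n] up to [k] lies in the graph-closed set
    [B j k] of branches bounded by [n], and the intersection [Binf j] of these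
    lies in [A j]. *)
Lemma compare_layers EE EEhat t w M e J (A : nat -> set Omega) :
  convex_expectation X EE -> convex_expectation X EEhat ->
  (forall f, bounded_lip f ->
     EE (fun w' => f (X ^~ w')) t w <= EEhat (fun w' => f (X ^~ w')) t w) ->
  0 < e -> (forall j, analytic Fs (A j)) ->
  EE (layers M e J A) t w <= EEhat (layers M e J A) t w.
Proof.
move=> h hh hle e0 hA.
have F0 : Fs set0 by exact: generated0.
have FT : Fs setT by exact: generatedT.
have /choice[S hS] : forall j, exists S : seq nat -> set Omega,
    (forall s, graph_closed X (S s)) /\ A j = dominated_part S [::].
  move=> j; have : analytic (graph_closed X) (A j).
    by apply: analytic_idem; apply: (analytic_mono (full_sigma_analytic hcad)).
  by move=> [S cS ->]; exists S; rewrite dominated_part_nil.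
pose D s j := dominated_part (S j) s.
have uD s : usab Fs (layers M e J (D s)).
  apply: layers_usab => // [|j]; first exact: ltW.
  by apply: dominated_part_analytic; exact: (hS j).1.
have AE : A = D [::] by apply/funext => j; exact: (hS j).2.
apply/ler_addgt0Pr => d d0; rewrite -lerBlDr.
set alpha := _ - d.
have [||n hn] := @prefix_choice (fun s => alpha < EE (layers M e J (D s)) t w).
- by rewrite /alpha AE ltrBlDr ltrDl.
- move=> s hs.
  have [_] : nondecreasing_seq (fun n => EE (layers M e J (D (rcons s n))) t w) /\
      EE (layers M e J (D (rcons s n))) t w @[n --> \oo] --> EE (layers M e J (D s)) t w.
    apply: (ce_cont_below h) => //.
    apply: layers_increases => [|n j|j]; first exact: ltW.
      exact: dominated_part_rcons.
    exact: dominated_part_bigcup.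
  by move=> /cvgr_gt/(_ _ hs)[n _ hn]; exists n; exact: hn (leqnn n).
pose B j k := bounded_branch (S j) [::] (mkseq n k).
have cB j k : graph_closed X (B j k) by apply: bounded_branch_closed; exact: (hS j).1.
have dB j k : B j k.+1 `<=` B j k by exact: (@bounded_branch_mono _ _ _ n 0).
have /choice[V hV] j := closed_outer_lip e0 (cB j) (dB j).
pose v k x := - M + \sum_(j < J) V j k x.
have bv k : bounded_lip (v k).
  apply: bounded_lipD; first exact: bounded_lip_cst.
  by apply: (@bounded_lip_sum _ _ J (fun j => V j k)) => j; have [] := hV j.
pose Binf j := \bigcap_k B j k.
have dv : decreases_to (fun k w' => v k (X ^~ w')) (layers M e J Binf).
  move=> w'; split.
    move=> k k' kk; rewrite lerD2l; apply: ler_sum => j _.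
    by have [_ _ /(_ w')[]] := hV j => + _; apply.
  apply: cvgD; first exact: cvg_cst.
  by apply: cvg_big => [|j _]; [exact: add_continuous|have [_ _ /(_ w')[_]] := hV j].
have BA j : Binf j `<=` A j.
  move=> w' hw'; rewrite AE.
  have [p hp] := @koenig _ (S j) n w' (fun k => hw' k I).
  by exists p.
have uB : usab Fs (layers M e J Binf).
  apply: layers_usab => // [|j]; first exact: ltW.
  by apply: analytic_bigcap => k; exact: graph_closed_analytic.
have lim : EEhat (fun w' => v k (X ^~ w')) t w @[k --> \oo] -->
    EEhat (layers M e J Binf) t w.
  have cv k : Cb (fun w' => v k (X ^~ w')) by exact: hCb.
  exact: (ce_cont_above hh t cv uB dv w).2.
apply: (@le_trans _ _ (EEhat (layers M e J Binf) t w)); last first.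
  apply: (ce_monotone hh) => // [|w'].
    by rewrite AE; exact: uD.
  by apply: layers_mono => //; exact: ltW.
(* It remains to bound [alpha] by the value of [EEhat] on each [v k]. *)
apply: (cvgr_to_ge lim); exists 0%N => // k _ /=.
apply: le_trans (hle _ (bv k)); apply: le_trans (ltW (hn k)) _.
apply: (ce_monotone h) => // [|w']; first exact: bounded_lip_usab.
rewrite lerD2l; apply: ler_sum => j _.
have [_ ge _] := hV j; apply: le_trans (ge k w').
rewrite ler_pM2l // !indicE; have [wD|//] := boolP (w' \in D (mkseq n k) j).
rewrite mem_set //; have [p [h1 h2]] := set_mem wD.
apply: (@branch_bounded _ (S j) p n w' 0 k) => // i ik.
by have := h1 i; rewrite size_mkseq => /(_ ik); rewrite nth_mkseq.
Qed.

End Capacity.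

(** * Cadlag and continuous path spaces *)

Section PathKinds.
Context {R : realType} {E : metricType R}.

Lemma coord_cadlag k (w : path_space E k) : cadlag ((coord_process E k) ^~ w).
Proof.
case: k w => /= w; first exact: (set_valP w).
move=> t; have ct : {for t, continuous (set_val w : R -> E)} by exact: (set_valP w).
split; first exact: cvg_at_right_filter.
by exists (set_val w t); exact: cvg_at_left_filter.
Qed.

(** All that is used of the topology is that paths near [w] are close to [w]
    in graph. *)
Lemma bounded_lip_continuous (T : topologicalType) (X : R -> T -> E)
    (f : (R -> E) -> R) :
  (forall w e, 0 < e -> \forall w' \near w, graph_close e (X ^~ w) (X ^~ w')) ->
  bounded_lip f -> Cb (fun w => f (X ^~ w)).
Proof.
move=> hX [[M hM] [L L0 hL]]; split; last by apply: (@bounded_funI _ _ _ M) => w.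
move=> w; apply/cvgrPdist_le => e e0.
have e'0 : 0 < e / L by rewrite divr_gt0.
apply: filterS (hX w _ e'0) => w' ww'; apply: le_trans (hL _ _) _.
by rewrite mulrC -ler_pdivlMr //; exact: graph_dist_le.
Qed.

(** The point of the graph over [s] is matched by the one over [lam s], and
    conversely through the inverse; the window grows by [e] because the inverse
    moves times by less than [e]. *)
Lemma J1_close_graph (e : R) (x y : cadlag_path E) : 0 < e ->
  J1_close (e^-1 + e) e (x, y) -> graph_close e (set_val x) (set_val y).
Proof.
move=> e0 [lam [_ [mu lamK muK]] [/= h1 h2]]; split=> s se.
  by exists (lam s) => //; apply: h2; rewrite (le_trans se) // lerDl ltW.
have ms : `|mu s - s| < e by have := h1 (mu s); rewrite muK distrC.
exists (mu s) => //; rewrite metric_sym -{2}(muK s); apply: h2.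
by have := ler_normD (mu s - s) s; rewrite subrK; lra.
Qed.

(** In the local uniform case each time is matched with itself; in the [J1]
    case with its image under the time change. *)
Lemma coord_graph_near k (w : path_space E k) (e : R) : 0 < e ->
  \forall w' \near w,
    graph_close e ((coord_process E k) ^~ w) ((coord_process E k) ^~ w').
Proof.
case: k w => /= w e0.
  have ent : entourage (J1_close (e^-1 + e) e : set (cadlag_path E * cadlag_path E)).
    by exists (e^-1 + e), e; split => //; exact: subset_refl.
  have := nbhs_entourage w ent; apply: filterS => w'.
  by move=> /xsectionP; exact: J1_close_graph.
have cw : {for w, continuous (set_val : continuous_path E -> {family compact, R -> E})}.
  exact: initial_continuous.
have entE : entourage [set p : E * E | mdist p.1 p.2 < e].
  rewrite (_ : [set p | _] = [set p | ball p.1 e p.2]).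
    exact: (entourage_ball E (PosNum e0)).
  by apply/funext => p /=; rewrite ballEmdist.
have ck : compact `[- e^-1, e^-1] by exact: segment_compact.
have nw : nbhs w (set_val @^-1` [set g : R -> E | forall s, `[- e^-1, e^-1]%classic s ->
    mdist (set_val w s) (g s) < e]).
  exact: cw (@fam_nbhs R E compact `[- e^-1, e^-1] _ (set_val w) entE ck).
apply: filterS nw => w' /= h.
have ws s : `|s| <= e^-1 -> mdist (set_val w s) (set_val w' s) < e.
  by move=> se; apply: h; rewrite /= in_itv /= -ler_norml.
split => s se; exists s; rewrite ?subrr ?normr0 //; first exact: ws.
by rewrite metric_sym; exact: ws.
Qed.

Lemma coord_Cb k (f : (R -> E) -> R) : bounded_lip f ->
  Cb (fun w : path_space E k => f ((coord_process E k) ^~ w)).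
Proof. by apply: bounded_lip_continuous => w e; exact: coord_graph_near. Qed.

End PathKinds.

(** The layers have height [1/a], where [a] is the constant of [ce_perturb]:
    the rounding error [1/a] then costs at most [d]. *)
Lemma compare_usab (R : realType) (E : metricType R) (Omega : topologicalType)
    (X : R -> Omega -> E)
    (EE EEhat : (Omega -> R) -> R -> Omega -> R) (t : R) (w : Omega) :
  (exists2 D : set E, countable D & dense D) ->
  (forall w, cadlag (X ^~ w)) ->
  (forall f : (R -> E) -> R, bounded_lip f -> Cb (fun w => f (X ^~ w))) ->
  convex_expectation X EE -> convex_expectation X EEhat ->
  (forall phi, cylinder_after X t phi -> EE phi t w <= EEhat phi t w) ->
  forall phi, usab (full_sigma X) phi -> EE phi t w <= EEhat phi t w.
Proof.
move=> hsep hcad hCb h hh hcyl phi uphi.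
have F0 : full_sigma X set0 by exact: generated0.
have FT : full_sigma X setT by exact: generatedT.
have [M hM] := usab_bound uphi.
apply/ler_addgt0Pr => d d0.
have [a a0 ha] := ce_perturb X t w M d0.
have aV0 : 0 < a^-1 by rewrite invr_gt0.
pose J := (Num.truncn ((M + M) / a^-1)).+1.
have hJ : M + M <= J%:R * a^-1.
  by rewrite -ler_pdivrMr // ltW // truncnS_gt.
pose A j := [set x | j.+1%:R * a^-1 - M <= phi x].
have hA j : analytic (full_sigma X) (A j) by exact: uphi.2.
have approx x := layers_approx aV0 (hM x) hJ.
have uL : usab (full_sigma X) (layers M a^-1 J A).
  by apply: layers_usab => //; exact: ltW.
have s1 : EE phi t w <= EE (fun x => layers M a^-1 J A x + a^-1) t w.
  apply: (ce_monotone h) => // [|x]; first by apply: usabD => //; exact: usab_cst.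
  by have [_ /andP[]] := approx x.
have s2 : EE (fun x => layers M a^-1 J A x + a^-1) t w <= EE (layers M a^-1 J A) t w + d.
  apply: (ha EE _ (fun=> a^-1)) => // [|x|].
  - exact: usab_cst.
  - have [lM /andP[lphi _]] := approx x.
    by rewrite ler_norml lM (le_trans lphi) // (le_trans (ler_norm _) (hM x)).
  - by rewrite (ce_cst t w _ h) divff // gt_eqF.
have s3 : EE (layers M a^-1 J A) t w <= EEhat (layers M a^-1 J A) t w.
  apply: (compare_layers hsep hcad hCb M J h hh) => // f bf.
  exact: (compare_bounded_lip hsep hcad hCb h hh).
have s4 : EEhat (layers M a^-1 J A) t w <= EEhat phi t w.
  apply: (ce_monotone hh) => // x.
  by have [_ /andP[]] := approx x.
lra.
Qed.

Theorem theorem2p12 (R : realType) (E : metricType R) (hE : polish E)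
    (k : path_kind)
    (EE EEhat : (path_space E k -> R) -> R -> path_space E k -> R)
    (hEE : convex_expectation (coord_process E k) EE)
    (hEEhat : convex_expectation (coord_process E k) EEhat)
    (hEE_disc : no_fixed_discontinuity (coord_process E k) EE)
    (hEEhat_disc : no_fixed_discontinuity (coord_process E k) EEhat)
    (t : R) :
  (forall phi, cylinder_after (coord_process E k) t phi ->
     forall w, EE phi t w <= EEhat phi t w)
  <->
  (forall phi, usab (full_sigma (coord_process E k)) phi ->
     forall w, EE phi t w <= EEhat phi t w).
Proof.
have [hsep _] := hE; split=> hle phi hphi w.
  apply: (compare_usab hsep) hphi => // [v|f|psi cpsi].
  - exact: coord_cadlag.
  - exact: coord_Cb.
  - exact: hle.
by apply: hle; exact: cylinder_usab hphi.
Qed.
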